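(* Let $m\in\mathbb{Z}\setminus\{0\}$, let $a,c\in\mathbb{C}$, and let $y=F_m(x):=1-(1-x)^m$. Assume that either (1) $m\in\{-2,-1,1,2\}$ (with $a,c\in\mathbb{C}$ arbitrary), or (2) $a-c\in\mathbb{Z}$ (with $m\in\mathbb{Z}\setminus\{0\}$ arbitrary). Assume that all parameters are permissible, i.e. $c+j\frac{a-c}{|m|}\notin\{0,-1,-2,\dots\}$ for $j=0,1,\dots,|m|-1$, and, if $m<0$, also for $j=|m|$. Then, as operators on $C^\omega$, $$\mathcal{H}_{c}^{a}(x)=\left(\frac{mx}{y}\right)^{1-c}(1-y)^{1+\frac{c-a}{m}}\left(\prod_{j=1}^{m}(1-y)^{\frac{a-c-1}{m}}\,\mathcal{H}_{c+(j-1)\frac{a-c}{m}}^{c+j\frac{a-c}{m}}(y)\right)\left(\frac{mx}{y}\right)^{a-1}.$$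
   Context: $C^\omega$ is the space of (germs of) functions analytic near $0\in\mathbb{C}$. $(q)_n=q(q+1)\cdots(q+n-1)$, $(q)_0=1$. For $a,c\in\mathbb{C}$ with $c\notin\{0,-1,-2,\dots\}$ the hypergeometrization is the linear operator $\mathcal{H}_c^a:C^\omega\to C^\omega$, $\mathcal{H}_c^a\left(\sum_n f_nx^n\right)=\sum_n f_n\frac{(a)_n}{(c)_n}x^n$; it is also denoted $\mathcal{H}_c^a(x)$. If also $a\notin\{0,-1,-2,\dots\}$ it is invertible with inverse $\mathcal{H}_a^c$. If $y=y(x)$ is analytic near $0$ with $y(0)=0$, $y'(0)\neq0$, then every $f\in C^\omega$ is uniquely $f=g\circ y$ with $g\in C^\omega$, and $\mathcal{H}_c^a(y)f:=(\mathcal{H}_c^a g)\circ y$ (hypergeometrization with respect to the variable $y$). A function $h\in C^\omega$ written in an operator expression denotes multiplication by $h$, and juxtaposition denotes composition of operators. Here $mx/y$ (extended to $x=0$) and $1-y$ equal $1$ at $x=0$, and their complex powers are the branches with value $1$ at $x=0$. Products are ordered: for $m\ge1$, $\prod_{j=1}^{m}A_j=A_1A_2\cdots A_m$. For negative upper limit, with $A_j$ invertible, $\prod_{j=1}^{-m}A_j:=\prod_{j=1}^{m}A_{1-j}^{-1}=A_0^{-1}A_{-1}^{-1}\cdots A_{1-m}^{-1}$ for $m\in\{1,2,\dots\}$; here the factor is $A_j=(1-y)^{\frac{a-c-1}{m}}\mathcal{H}_{c+(j-1)\frac{a-c}{m}}^{c+j\frac{a-c}{m}}(y)$, defined for every integer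 $j$ for which its parameters are permissible. *)

(* Defs.v *)
From Stdlib Require Export Reals ZArith ClassicalEpsilon.
From Coquelicot Require Export Coquelicot.

Open Scope R_scope.
Open Scope C_scope.

(* A germ at [0] is represented by any function [C -> C] having that germ. *)
Definition analytic0 (f : C -> C) : Prop :=
  exists b : nat -> C, locally (RtoC 0) (fun x => is_pseries b x (f x)).

Definition germ_eq (f g : C -> C) : Prop :=
  locally (RtoC 0) (fun x => f x = g x).

Definition op : Type := (C -> C) -> (C -> C).

Definition op_eq (A B : op) : Prop :=
  forall f, analytic0 f -> germ_eq (A f) (B f).

Definition op_id : op := fun f => f.
Definition op_comp (A B : op) : op := fun f => A (B f).
Definition op_mul (h : C -> C) : op := fun f x => h x * f x.

(* The germ inverse of an operator; meaningful on the range of an [A] that is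
   injective on germs. *)
Definition op_inv (A : op) : op := fun f =>
  epsilon (inhabits (fun _ => RtoC 0))
    (fun g => analytic0 g /\ germ_eq (A g) f).

Declare Scope op_scope.
Delimit Scope op_scope with op.
Bind Scope op_scope with op.
Notation "A ** B" := (op_comp A%op B%op)
  (at level 40, left associativity) : op_scope.

Fixpoint op_prod_nat (A : nat -> op) (n : nat) : op :=
  match n with
  | O => op_id
  | S k => (op_prod_nat A k ** A (S k))%op
  end.

(* [A 1 ** ... ** A m] for [m > 0], and
   [op_inv (A 0) ** op_inv (A (-1)) ** ... ** op_inv (A (1 + m))] for [m < 0]. *)
Definition op_prod (A : Z -> op) (m : Z) : op :=
  match m with
  | Z0 => op_id
  | Zpos p => op_prod_nat (fun j => A (Z.of_nat j)) (Pos.to_nat p)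
  | Zneg p => op_prod_nat (fun j => op_inv (A (1 - Z.of_nat j)%Z)) (Pos.to_nat p)
  end.

Fixpoint poch (q : C) (n : nat) : C :=
  match n with
  | O => 1
  | S k => poch q k * (q + INR k)
  end.

Definition permissible (c : C) : Prop := forall n : nat, c <> - RtoC (INR n).

Definition taylor (f : C -> C) : nat -> C :=
  epsilon (inhabits (fun _ => RtoC 0))
    (fun b => locally (RtoC 0) (fun x => is_pseries b x (f x))).

Definition psum (b : nat -> C) (x : C) : C :=
  epsilon (inhabits (RtoC 0)) (fun s => is_pseries b x s).

(* [hyp a c] has upper parameter [a] and lower parameter [c]. *)
Definition hyp (a c : C) : op := fun f =>
  psum (fun n => taylor f n * (poch a n / poch c n)).

(* The germ [g] with [f = g o y]. *)
Definition factor_through (y f : C -> C) : C -> C :=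
  epsilon (inhabits (fun _ => RtoC 0))
    (fun g => analytic0 g /\ germ_eq f (fun x => g (y x))).

Definition hyp_wrt (y : C -> C) (a c : C) : op := fun f x =>
  hyp a c (factor_through y f) (y x).

Definition Cexp (z : C) : C :=
  RtoC (exp (Re z)) * (cos (Im z), sin (Im z)).

(* Principal logarithm on the plane slit along the nonpositive reals: there the
   argument is [2 * atan (Im z / (|z| + Re z))]. *)
Definition Clog (z : C) : C :=
  (ln (Cmod z), (2 * atan (Im z / (Cmod z + Re z)))%R).

(* Principal power. When [h] is continuous at [0] and [h 0 = 1], the function
   [fun x => Cpower (h x) alpha] is, near [0], the branch of [h ^ alpha] with
   value [1] at [0]. *)
Definition Cpower (z alpha : C) : C := Cexp (alpha * Clog z).

Definition Cpow_Z (z : C) (m : Z) : C :=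
  match m with
  | Z0 => 1
  | Zpos p => z ^ Pos.to_nat p
  | Zneg p => / z ^ Pos.to_nat p
  end.

Definition Fm (m : Z) (x : C) : C := 1 - Cpow_Z (1 - x) m.

(* [m x / y] with [y = Fm m x], extended by [1] at [x = 0]. *)
Definition mx_over_y (m : Z) (x : C) : C :=
  if Ceq_dec x 0 then RtoC 1 else RtoC (IZR m) * x / Fm m x.

Definition op_pow (h : C -> C) (alpha : C) : op :=
  op_mul (fun x => Cpower (h x) alpha).

Definition hyp_factor (m : Z) (a c : C) (j : Z) : op :=
  let y := Fm m in
  let d := (a - c) / RtoC (IZR m) in
  (op_pow (fun x => 1 - y x) ((a - c - 1) / RtoC (IZR m)) **
   hyp_wrt y (c + RtoC (IZR j) * d) (c + RtoC (IZR (j - 1)) * d))%op.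

(* Main.v *)
Require Import Defs.
From Stdlib Require Import Lia Lra FunctionalExtensionality List Permutation.

(** Write [t = 1 - x] and [y = 1 - t^m], so that [1 - y = t^m].  Suppose first that
    [c] is a positive integer and that [(a - c)/|m|] is a natural number [e].  Then
    the identity is one between differential operators.  Since
    [H_b^(b+e) = ((b)_e)^-1 x^(1-b) (d/dx)^e x^(b+e-1)], the left-hand side is a
    derivative of order [|m| e] in [x], and the right-hand side is, up to powers of
    [t], a product of [|m|] derivatives of order [e] in [y] ([fprod_fDy]): the
    powers of [y] between consecutive factors cancel.  With the Euler derivation
    [Q = t d/dt], for which [Q t^al = t^al (Q + al)], every operator of this kind is
    a power of [t] times a product of factors [Q - r].  On the left the exponents
    [r] are [0, ..., |m| e - 1]; on the right each factor contributes one residue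
    class modulo [|m|] of the same numbers ([fD_factor]).  The factors commute, so
    the two sides agree ([frhs_integer]).

    For general parameters, every Taylor coefficient of either side is a rational
    function of the parameters without poles at permissible ones, and a rational
    function with infinitely many zeros vanishes.  This extends the identity from
    positive integers [c] to all permissible [c], and then from natural numbers
    [(a - c)/|m|] to all permissible values ([frhs_continuation]).

    These steps are carried out for formal power series.  To pass to germs it is
    shown that products, substitutions and complex powers of convergent power
    series converge to the products, composites and powers of their sums
    ([psum_mul], [psum_comp], [Clog_psum]); then every operator of the statement
    acts on Taylor coefficients as its formal counterpart ([op_repr]), and a germ is
    determined by its Taylor coefficients ([repr_unique]). *)

(** * Formal power series *)

Definition fps : Type := nat -> C.

Declare Scope fps_scope.
Delimit Scope fps_scope with fps.
Bind Scope fps_scope with fps.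

Definition ftail (f : fps) : fps := fun n => f (S n).
Definition fconst (z : C) : fps := fun n => match n with O => z | S _ => 0 end.
Definition fadd (f g : fps) : fps := fun n => f n + g n.
Definition fopp (f : fps) : fps := fun n => - f n.
Definition fsub (f g : fps) : fps := fun n => f n - g n.

(** The Cauchy product, by recursion on the first factor: with [f = f 0 + x * ftail f]
    the ring laws become short inductions. *)
Definition fmul : fps -> fps -> fps :=
  fix fmul (f g : fps) (n : nat) : C :=
    match n with
    | O => f O * g O
    | S k => f O * g (S k) + fmul (ftail f) g k
    end.

Notation "f + g" := (fadd f g) : fps_scope.
Notation "f - g" := (fsub f g) : fps_scope.
Notation "f * g" := (fmul f g) : fps_scope.
Notation "- f" := (fopp f) : fps_scope.

Lemma fmul_ftail_r f g n :
  (f * g)%fps (S n) = f (S n) * g O + (f * ftail g)%fps n.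
Proof.
  revert f; induction n as [|n IH]; intros f.
  - simpl. unfold ftail. ring.
  - change ((f * g)%fps (S (S n))) with (f O * g (S (S n)) + (ftail f * g)%fps (S n)).
    rewrite IH.
    change ((f * ftail g)%fps (S n)) with (f O * g (S (S n)) + (ftail f * ftail g)%fps n).
    unfold ftail at 1. ring.
Qed.

Lemma fmul_comm f g : (f * g)%fps = (g * f)%fps.
Proof.
  extensionality n. revert f g; induction n as [|n IH]; intros f g.
  - simpl. ring.
  - rewrite fmul_ftail_r. simpl. rewrite IH. ring.
Qed.

Lemma fmul_add_l f g h : ((f + g) * h = f * h + g * h)%fps.
Proof.
  extensionality n. revert f g; induction n as [|n IH]; intros f g.
  - simpl. unfold fadd. simpl. ring.
  - change (((f + g) * h)%fps (S n))
      with ((f O + g O) * h (S n) + ((ftail f + ftail g) * h)%fps n).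
    rewrite IH. unfold fadd. simpl. ring.
Qed.

Lemma fmul_const z f n : (fconst z * f)%fps n = z * f n.
Proof.
  assert (H0 : forall f n, (fconst 0 * f)%fps n = 0).
  { clear. intros f n. revert f; induction n as [|n IH]; intros f; simpl.
    - ring.
    - change (ftail (fconst 0)) with (fun _ : nat => RtoC 0).
      replace (fun _ : nat => RtoC 0) with (fconst 0)
        by (extensionality k; destruct k; reflexivity).
      rewrite IH. ring. }
  destruct n as [|n]; simpl; [reflexivity|].
  replace (ftail (fconst z)) with (fconst 0)
    by (extensionality k; destruct k; reflexivity).
  rewrite H0. ring.
Qed.

Lemma fmul_assoc f g h : (f * (g * h) = f * g * h)%fps.
Proof.
  extensionality n. revert f; induction n as [|n IH]; intros f.
  - simpl. ring.
  - change ((f * (g * h))%fps (S n))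
      with (f O * (g * h)%fps (S n) + (ftail f * (g * h))%fps n).
    rewrite IH.
    change ((f * g * h)%fps (S n))
      with ((f O * g O) * h (S n) + (ftail (f * g)%fps * h)%fps n).
    replace (ftail (f * g)%fps) with (fconst (f O) * ftail g + ftail f * g)%fps
      by (extensionality k; unfold fadd; rewrite fmul_const; reflexivity).
    rewrite fmul_add_l. unfold fadd.
    replace (fconst (f O) * ftail g)%fps with (fun k => f O * ftail g k : C)
      by (extensionality k; now rewrite fmul_const).
    assert (E : forall z g n, (((fun k => z * g k : C) : fps) * h)%fps n = z * (g * h)%fps n).
    { clear. intros z g n; revert g; induction n as [|n IH]; intros g; simpl.
      - ring.
      - change (ftail (fun k => z * g k)) with (fun k => z * ftail g k).
        rewrite IH. ring. }
    rewrite E. change ((g * h)%fps (S n)) with (g O * h (S n) + (ftail g * h)%fps n).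
    ring.
Qed.

Lemma fps_ring_theory :
  ring_theory (fconst 0) (fconst 1) fadd fmul fsub fopp (@eq fps).
Proof.
  constructor; intros; try (extensionality n; unfold fadd, fsub, fopp).
  - destruct n; simpl; ring.
  - ring.
  - ring.
  - rewrite fmul_const. ring.
  - now rewrite fmul_comm.
  - now rewrite fmul_assoc.
  - change (fun n => x n + y n) with (x + y)%fps. now rewrite fmul_add_l.
  - ring.
  - destruct n; simpl; ring.
Qed.

Add Ring fps_ring : fps_ring_theory.

Lemma fconst_add z w : fconst (z + w) = (fconst z + fconst w)%fps.
Proof. extensionality n; destruct n; unfold fadd; simpl; ring. Qed.

Lemma fconst_mul z w : fconst (z * w) = (fconst z * fconst w)%fps.
Proof. extensionality n; rewrite fmul_const; destruct n; simpl; ring. Qed.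

Lemma fconst_opp z : fconst (- z) = (- fconst z)%fps.
Proof. extensionality n; destruct n; unfold fopp; simpl; ring. Qed.

Fixpoint fpow (f : fps) (n : nat) : fps :=
  match n with O => fconst 1 | S k => (f * fpow f k)%fps end.

Definition fX : fps := fun n => match n with 1%nat => 1 | _ => 0 end.

Lemma fX_mul_0 f : (fX * f)%fps O = 0.
Proof. simpl. ring. Qed.

Lemma fX_mul_S f n : (fX * f)%fps (S n) = f n.
Proof.
  simpl. replace (ftail fX) with (fconst 1)
    by (extensionality k; destruct k; reflexivity).
  rewrite fmul_const. ring.
Qed.

Lemma fps_decomp f : f = (fconst (f O) + fX * ftail f)%fps.
Proof.
  extensionality n; unfold fadd; destruct n.
  - rewrite fX_mul_0. simpl. ring.
  - rewrite fX_mul_S. unfold ftail. simpl. ring.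
Qed.

Lemma fX_pow_cancel n f g : (fpow fX n * f = fpow fX n * g)%fps -> f = g.
Proof.
  induction n as [|n IH]; simpl; intros H.
  - rewrite <- (fps_ring_theory.(Rmul_1_l) f), H. ring.
  - apply IH. extensionality k.
    rewrite <- (fX_mul_S (fpow fX n * f) k), <- (fX_mul_S (fpow fX n * g) k).
    now rewrite !fmul_assoc, H.
Qed.

Lemma fpow_mul f g n : fpow (f * g)%fps n = (fpow f n * fpow g n)%fps.
Proof. induction n as [|n IH]; simpl; [ring | rewrite IH; ring]. Qed.

Lemma fpow_const z n : fpow (fconst z) n = fconst (Cpow z n).
Proof. induction n as [|n IH]; simpl; [reflexivity | rewrite IH, fconst_mul; reflexivity]. Qed.

(** * Substitution *)

Lemma fmul_ext_upto (h f g : fps) n :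
  (forall k, (k <= n)%nat -> f k = g k) -> (h * f)%fps n = (h * g)%fps n.
Proof.
  revert h; induction n as [|n IH]; intros h H; simpl.
  - now rewrite H.
  - rewrite (IH (ftail h)), H by (intros; try apply H; lia). reflexivity.
Qed.

Lemma fmul_ext_below (y f g : fps) n :
  y O = 0 -> (forall k, (k < n)%nat -> f k = g k) -> (y * f)%fps n = (y * g)%fps n.
Proof.
  intros y0 H; destruct n as [|n]; simpl; rewrite y0.
  - ring.
  - rewrite (fmul_ext_upto (ftail y) f g n) by (intros; apply H; lia). ring.
Qed.

(** Every substitution law below is an instance of this principle.  Multiplication by
    [y] raises the order, so a family that reproduces itself with a factor [y] vanishes
    to every order; it is applied to the difference of the two sides of a law. *)
Lemma fps_contraction (A : Type) (next : A -> A) (F : A -> fps) (y : fps) :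
  y O = 0 -> (forall a, F a = (y * F (next a))%fps) -> forall a, F a = fconst 0.
Proof.
  intros y0 H.
  assert (E : forall n a, F a n = 0).
  { induction n as [n IH] using (well_founded_induction lt_wf); intros a.
    rewrite H, (fmul_ext_below y _ (fconst 0) n y0), fmul_comm, fmul_const.
    - ring.
    - intros k Hk. rewrite IH by exact Hk. destruct k; reflexivity. }
  intros a; extensionality n. rewrite E. destruct n; reflexivity.
Qed.

Lemma fsub_eq0 f g : (f - g)%fps = fconst 0 -> f = g.
Proof.
  intros H. transitivity ((f - g) + g)%fps; [ring | rewrite H; ring].
Qed.

(** The Horner scheme for [sum g_n y^n], cut off after [N] steps.  As [y] has no
    constant term, [n] steps determine the coefficient of [x^n]. *)
Fixpoint comp_fuel (N : nat) (g y : fps) : fps :=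
  match N with
  | O => fconst (g O)
  | S k => (fconst (g O) + y * comp_fuel k (ftail g) y)%fps
  end.

Definition comp (g y : fps) : fps := fun n => comp_fuel n g y n.

Lemma comp_fuel_enough (y : fps) : y O = 0 ->
  forall n N g, (n <= N)%nat -> comp_fuel N g y n = comp g y n.
Proof.
  intros y0; induction n as [n IH] using (well_founded_induction lt_wf).
  intros N g H. unfold comp. destruct n as [|n].
  - destruct N; simpl; [reflexivity|]. unfold fadd; simpl. rewrite y0. ring.
  - destruct N as [|N]; [lia|]. simpl comp_fuel. unfold fadd. f_equal.
    apply fmul_ext_below; [exact y0|]. intros k Hk.
    rewrite !IH by lia. reflexivity.
Qed.

Lemma comp_rec (g y : fps) : y O = 0 -> comp g y = (fconst (g O) + y * comp (ftail g) y)%fps.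
Proof.
  intros y0. extensionality n. destruct n as [|n].
  - unfold comp, fadd; simpl. rewrite y0. ring.
  - unfold comp at 1; simpl comp_fuel. unfold fadd. f_equal.
    apply fmul_ext_below; [exact y0|]. intros k Hk.
    apply comp_fuel_enough; [exact y0 | lia].
Qed.

Section Composition.
Variable y : fps.
Hypothesis y0 : y O = 0.

Lemma comp_add f g : comp (f + g)%fps y = (comp f y + comp g y)%fps.
Proof.
  apply fsub_eq0.
  refine (fps_contraction (fps * fps) (fun p => (ftail (fst p), ftail (snd p)))
    (fun p => (comp (fst p + snd p) y - (comp (fst p) y + comp (snd p) y))%fps)
    y y0 _ (f, g)).
  clear f g; intros [f g]; simpl.
  rewrite (comp_rec (f + g)%fps), (comp_rec f), (comp_rec g) by exact y0.
  change (ftail (f + g)%fps) with (ftail f + ftail g)%fps.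
  change ((f + g)%fps O) with (f O + g O). rewrite fconst_add. ring.
Qed.

Lemma comp_scal z f : comp (fconst z * f)%fps y = (fconst z * comp f y)%fps.
Proof.
  apply fsub_eq0.
  refine (fps_contraction fps ftail
    (fun f => (comp (fconst z * f) y - fconst z * comp f y)%fps) y y0 _ f).
  clear f; intros f.
  rewrite (comp_rec (fconst z * f)%fps), (comp_rec f) by exact y0.
  replace (ftail (fconst z * f)%fps) with (fconst z * ftail f)%fps
    by (extensionality n; unfold ftail at 2; now rewrite !fmul_const).
  rewrite fmul_const, fconst_mul. ring.
Qed.

Lemma comp_const z : comp (fconst z) y = fconst z.
Proof.
  assert (H : comp (fconst 0) y = fconst 0).
  { refine (fps_contraction unit (fun u => u) (fun _ => comp (fconst 0) y) y y0 _ tt).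
    intros _. rewrite (comp_rec (fconst 0)) at 1 by exact y0.
    replace (ftail (fconst 0)) with (fconst 0)
      by (extensionality n; destruct n; reflexivity). simpl. ring. }
  rewrite comp_rec by exact y0.
  replace (ftail (fconst z)) with (fconst 0)
    by (extensionality n; destruct n; reflexivity).
  rewrite H. simpl. ring.
Qed.

Lemma comp_fX_mul f : comp (fX * f)%fps y = (y * comp f y)%fps.
Proof.
  rewrite comp_rec, fX_mul_0 by exact y0.
  replace (ftail (fX * f)%fps) with f
    by (extensionality n; unfold ftail; now rewrite fX_mul_S). ring.
Qed.

Lemma comp_mul f g : comp (f * g)%fps y = (comp f y * comp g y)%fps.
Proof.
  apply fsub_eq0.
  refine (fps_contraction fps ftail
    (fun f => (comp (f * g) y - comp f y * comp g y)%fps) y y0 _ f).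
  clear f; intros f.
  rewrite (fps_decomp f) at 1.
  replace ((fconst (f O) + fX * ftail f) * g)%fps
    with (fconst (f O) * g + fX * (ftail f * g))%fps by ring.
  rewrite comp_add, comp_scal, comp_fX_mul, (comp_rec f) by exact y0. ring.
Qed.

Lemma comp_fX : comp fX y = y.
Proof.
  replace fX with (fX * fconst 1)%fps by ring.
  rewrite comp_fX_mul, comp_const. ring.
Qed.

Lemma comp_pow f n : comp (fpow f n) y = fpow (comp f y) n.
Proof.
  induction n as [|n IH]; simpl; [apply comp_const | now rewrite comp_mul, IH].
Qed.

End Composition.

(** * Derivation *)

Definition fD (f : fps) : fps := fun n => (INR n + 1) * f (S n).

Lemma fD_decomp f : fD f = (ftail f + fX * fD (ftail f))%fps.
Proof.
  extensionality n; unfold fadd; destruct n as [|n].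
  - rewrite fX_mul_0. unfold fD, ftail. simpl INR. ring.
  - rewrite fX_mul_S. unfold fD, ftail. rewrite S_INR, RtoC_plus. ring.
Qed.

Lemma fD_add f g : fD (f + g)%fps = (fD f + fD g)%fps.
Proof. extensionality n; unfold fD, fadd; ring. Qed.

Lemma fD_scal z f : fD (fconst z * f)%fps = (fconst z * fD f)%fps.
Proof. extensionality n; unfold fD; rewrite !fmul_const; unfold fD; ring. Qed.

Lemma fD_const z : fD (fconst z) = fconst 0.
Proof. extensionality n; unfold fD; destruct n; simpl; ring. Qed.

Lemma fD_fX_mul f : fD (fX * f)%fps = (f + fX * fD f)%fps.
Proof.
  rewrite (fD_decomp (fX * f)%fps).
  replace (ftail (fX * f)%fps) with f
    by (extensionality n; unfold ftail; now rewrite fX_mul_S). reflexivity.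
Qed.

Lemma fD_mul f g : fD (f * g)%fps = (fD f * g + f * fD g)%fps.
Proof.
  apply fsub_eq0.
  refine (fps_contraction fps ftail
    (fun f => (fD (f * g) - (fD f * g + f * fD g))%fps) fX eq_refl _ f).
  clear f; intros f.
  assert (E : (f * g = fconst (f O) * g + fX * (ftail f * g))%fps)
    by (rewrite (fps_decomp f) at 1; ring).
  rewrite E, fD_add, fD_scal, fD_fX_mul, (fD_decomp f).
  replace (f * fD g)%fps with ((fconst (f O) + fX * ftail f) * fD g)%fps
    by now rewrite <- fps_decomp.
  ring.
Qed.

Lemma fD_comp (g y : fps) : y O = 0 -> fD (comp g y) = (comp (fD g) y * fD y)%fps.
Proof.
  intros y0. apply fsub_eq0.
  refine (fps_contraction fps ftail
    (fun g => (fD (comp g y) - comp (fD g) y * fD y)%fps) y y0 _ g).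
  clear g; intros g.
  rewrite (comp_rec g), (fD_decomp g), comp_add, comp_fX_mul by exact y0.
  rewrite fD_add, fD_const, fD_mul. ring.
Qed.

(** * Powers of 1 - x *)

(** The binomial series of [t^al], where [t = 1 - x]. *)
Definition tpow (al : C) : fps := fun n => poch (- al) n / INR (fact n).

Lemma RtoC_INR_S n : RtoC (INR (S n)) = INR n + 1.
Proof. now rewrite S_INR, RtoC_plus. Qed.

Lemma INR_S_neq0 n : (INR n + 1)%C <> 0.
Proof.
  rewrite <- RtoC_INR_S. intros H. apply RtoC_inj in H.
  now apply (not_0_INR (S n)).
Qed.

Lemma fact_neq0 n : RtoC (INR (fact n)) <> 0.
Proof. intros H. apply RtoC_inj in H. now apply (INR_fact_neq_0 n). Qed.

(** The equation [(1 - x) f' = - z f] is the recursion [(n + 1) f_(n+1) = (n - z) f_n]. *)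
Lemma ode_unique z f :
  fD f = (fX * fD f - fconst z * f)%fps -> f = (fconst (f O) * tpow z)%fps.
Proof.
  intros H. extensionality n. rewrite fmul_const. unfold tpow.
  induction n as [|n IH].
  - simpl. field.
  - assert (E : (INR n + 1) * f (S n) = (INR n - z) * f n).
    { apply (f_equal (fun h : fps => h n)) in H. unfold fsub in H.
      rewrite fmul_const in H. unfold fD at 1 in H. rewrite H.
      destruct n as [|n]; [rewrite fX_mul_0; simpl INR; ring|].
      rewrite fX_mul_S. unfold fD. rewrite RtoC_INR_S. ring. }
    pose proof (INR_S_neq0 n) as N1. pose proof (fact_neq0 n) as N2.
    replace (f (S n)) with ((INR n - z) * f n / (INR n + 1))
      by (rewrite <- E; field; exact N1).
    rewrite IH. simpl poch. rewrite fact_simpl, mult_INR, RtoC_mult, RtoC_INR_S.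
    field. split; assumption.
Qed.

Lemma tpow_0 al : tpow al O = 1.
Proof. unfold tpow; simpl. field. Qed.

Lemma tpow_ode al : fD (tpow al) = (fX * fD (tpow al) - fconst al * tpow al)%fps.
Proof.
  extensionality n. unfold fsub. rewrite fmul_const.
  assert (E : forall n, (INR n + 1) * tpow al (S n) = (INR n - al) * tpow al n).
  { intros k. unfold tpow. simpl poch. rewrite fact_simpl, mult_INR, RtoC_mult, RtoC_INR_S.
    field. split; [apply fact_neq0 | apply INR_S_neq0]. }
  unfold fD at 1. rewrite E. destruct n as [|n].
  - rewrite fX_mul_0. simpl INR. ring.
  - rewrite fX_mul_S. unfold fD. rewrite RtoC_INR_S. ring.
Qed.

Lemma tpow_unique z f :
  fD f = (fX * fD f - fconst z * f)%fps -> f O = 1 -> f = tpow z.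
Proof. intros H H0. rewrite (ode_unique z f H), H0. ring. Qed.

Lemma tpow_add al be : (tpow al * tpow be)%fps = tpow (al + be).
Proof.
  apply tpow_unique; [|simpl; rewrite !tpow_0; ring].
  rewrite fD_mul, fconst_add.
  transitivity ((fX * fD (tpow al) - fconst al * tpow al) * tpow be
    + tpow al * (fX * fD (tpow be) - fconst be * tpow be))%fps; [now rewrite <- !tpow_ode | ring].
Qed.

Lemma tpow_zero : tpow 0 = fconst 1.
Proof.
  symmetry. apply tpow_unique; [|reflexivity]. rewrite fD_const. ring.
Qed.

Lemma tpow_one : tpow 1 = (fconst 1 - fX)%fps.
Proof.
  symmetry. apply tpow_unique.
  - replace (fconst 1 - fX)%fps with (fconst 1 + fconst (-(1)) * (fX * fconst 1))%fps
      by (rewrite fconst_opp; ring).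
    rewrite fD_add, fD_scal, fD_fX_mul, !fD_const, fconst_opp. ring.
  - unfold fsub; simpl. ring.
Qed.

Lemma fD_tpow al : fD (tpow al) = (- (fconst al * tpow (al - 1)))%fps.
Proof.
  assert (E : (tpow 1 * fD (tpow al) = - (fconst al * tpow al))%fps).
  { rewrite tpow_one. pose proof (tpow_ode al) as E.
    transitivity (fD (tpow al) - fX * fD (tpow al))%fps; [ring|].
    rewrite E at 1. ring. }
  transitivity (tpow (-(1)) * (tpow 1 * fD (tpow al)))%fps.
  - rewrite fmul_assoc, tpow_add. replace (-(1) + 1) with (RtoC 0) by ring.
    rewrite tpow_zero. ring.
  - rewrite E. replace (al - 1) with (-(1) + al) by ring. rewrite <- tpow_add. ring.
Qed.

Lemma fpow_tpow al n : fpow (tpow al) n = tpow (INR n * al).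
Proof.
  induction n as [|n IH]; cbn [fpow].
  - simpl INR. replace (RtoC 0 * al) with (RtoC 0) by ring. now rewrite tpow_zero.
  - rewrite IH, tpow_add, RtoC_INR_S. f_equal. ring.
Qed.

(** * Differential operators in t = 1 - x *)

(** The Euler derivation [t d/dt]. *)
Definition fQ (f : fps) : fps := (- (tpow 1 * fD f))%fps.

Fixpoint Qprod (L : list C) (f : fps) : fps :=
  match L with
  | nil => f
  | r :: L' => (fQ (Qprod L' f) - fconst r * Qprod L' f)%fps
  end.

Lemma fQ_tpow al f : fQ (tpow al * f)%fps = (tpow al * (fQ f + fconst al * f))%fps.
Proof.
  unfold fQ. rewrite fD_mul, fD_tpow.
  transitivity (fconst al * (tpow 1 * tpow (al - 1)) * f - tpow al * (tpow 1 * fD f))%fps; [ring|].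
  rewrite tpow_add. replace (1 + (al - 1)) with al by ring. ring.
Qed.

Lemma fQ_scal z f : fQ (fconst z * f)%fps = (fconst z * fQ f)%fps.
Proof. unfold fQ. rewrite fD_scal. ring. Qed.

Lemma fQ_sub f g : fQ (f - g)%fps = (fQ f - fQ g)%fps.
Proof.
  unfold fQ. replace (f - g)%fps with (f + fconst (-(1)) * g)%fps
    by (rewrite fconst_opp; ring).
  rewrite fD_add, fD_scal, fconst_opp. ring.
Qed.

Lemma Qprod_scal L z f : Qprod L (fconst z * f)%fps = (fconst z * Qprod L f)%fps.
Proof. induction L as [|r L IH]; simpl; [ring | rewrite IH, fQ_scal; ring]. Qed.

Lemma Qprod_app L1 L2 f : Qprod (L1 ++ L2) f = Qprod L1 (Qprod L2 f).
Proof. induction L1 as [|r L IH]; simpl; [reflexivity | now rewrite IH]. Qed.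

Definition lshift (al : C) (L : list C) : list C := map (fun r => r - al) L.

Lemma Qprod_tpow L al f : Qprod L (tpow al * f)%fps = (tpow al * Qprod (lshift al L) f)%fps.
Proof.
  induction L as [|r L IH]; simpl; [ring|].
  rewrite IH, fQ_tpow. replace (r - al) with (r + - al) by ring.
  rewrite fconst_add, fconst_opp. ring.
Qed.

Lemma Qprod_perm L1 L2 f : Permutation L1 L2 -> Qprod L1 f = Qprod L2 f.
Proof.
  induction 1 as [|r L1 L2 _ IH|r s L|L1 L2 L3 _ IH1 _ IH2]; simpl.
  - reflexivity.
  - now rewrite IH.
  - rewrite !fQ_sub, !fQ_scal. ring.
  - now rewrite IH1.
Qed.

(** The exponents that appear when [n] copies of [t^al * Qprod L] are multiplied and all
    powers of [t] are moved to the left: the copy that passes [t^(k al)] is shifted by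
    [k al]. *)
Fixpoint lrep (L : list C) (al : C) (n : nat) : list C :=
  match n with
  | O => nil
  | S k => lshift (INR k * al) L ++ lrep L al k
  end.

Lemma in_lrep L al n r i :
  (i < n)%nat -> In r L -> In (r - INR i * al) (lrep L al n).
Proof.
  intros Hi Hr; induction n as [|n IH]; [lia|]; simpl.
  apply in_or_app. destruct (Nat.eq_dec i n) as [->|Hne].
  - left. unfold lshift. apply (in_map (fun r => r - INR n * al)), Hr.
  - right. apply IH. lia.
Qed.

Lemma length_lrep L al n : length (lrep L al n) = (n * length L)%nat.
Proof.
  induction n as [|n IH]; simpl; [reflexivity|].
  unfold lshift. now rewrite length_app, length_map, IH.
Qed.

Lemma iter_tpow_Q z al L n f :
  Nat.iter n (fun g => fconst z * (tpow al * Qprod L g))%fps f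
  = (fconst (Cpow z n) * (tpow (INR n * al) * Qprod (lrep L al n) f))%fps.
Proof.
  induction n as [|n IH].
  - simpl. replace (RtoC 0 * al) with (RtoC 0) by ring. rewrite tpow_zero. ring.
  - rewrite Nat.iter_succ, IH, Qprod_scal, Qprod_tpow, <- Qprod_app.
    replace (INR (S n) * al) with (al + INR n * al) by (rewrite RtoC_INR_S; ring).
    rewrite <- tpow_add. simpl Cpow. rewrite fconst_mul. simpl lrep. ring.
Qed.

Lemma iter_ext (A : Type) (F G : A -> A) n f :
  (forall g, F g = G g) -> Nat.iter n F f = Nat.iter n G f.
Proof. intros H; induction n as [|n IH]; simpl; [reflexivity | now rewrite H, IH]. Qed.

Lemma in_lrep0 k r : In r (lrep (RtoC 0 :: nil) (-(1)) k) ->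
  exists i, (i < k)%nat /\ r = INR i.
Proof.
  induction k as [|k IH]; simpl; [easy|]. intros [<-|H].
  - exists k. split; [lia | ring].
  - destruct (IH H) as (i & Hi & E). exists i. split; [lia | exact E].
Qed.

Lemma NoDup_lrep0 k : NoDup (lrep (RtoC 0 :: nil) (-(1)) k).
Proof.
  induction k as [|k IH]; simpl; constructor; [|exact IH].
  intros H. destruct (in_lrep0 _ _ H) as (i & Hi & E).
  assert (E' : RtoC (INR k) = RtoC (INR i)) by (rewrite <- E; ring).
  apply RtoC_inj, INR_eq in E'. lia.
Qed.

(** The exponents [0, ..., M e - 1] are distinct and both lists have [M e] entries, so it
    suffices to find each of these numbers, written as [M l + i], on the right. *)
Lemma roots_perm L M e al :
  length L = e ->
  (forall l i, (l < e)%nat -> (i < M)%nat ->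
     exists r j, In r L /\ (j < M)%nat /\ r - INR j * al = INR (M * l + i)) ->
  Permutation (lrep (RtoC 0 :: nil) (-(1)) (M * e)) (lrep L al M).
Proof.
  intros HL H. apply NoDup_Permutation_bis.
  - apply NoDup_lrep0.
  - rewrite !length_lrep, HL. simpl. lia.
  - intros r Hr. destruct (in_lrep0 _ _ Hr) as (s & Hlt & ->).
    assert (HM : M <> 0%nat) by (intros ->; lia).
    rewrite (Nat.div_mod_eq s M).
    destruct (H (s / M)%nat (s mod M)%nat) as (r & j & Hr' & Hj & E).
    + apply Nat.Div0.div_lt_upper_bound. exact Hlt.
    + now apply Nat.mod_upper_bound.
    + rewrite <- E. now apply in_lrep.
Qed.

Lemma iter_fD k f :
  Nat.iter k fD f
  = (fconst (Cpow (-(1)) k) * (tpow (- INR k) * Qprod (lrep (RtoC 0 :: nil) (-(1)) k) f))%fps.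
Proof.
  rewrite (iter_ext _ _ (fun g => fconst (-(1)) * (tpow (-(1)) * Qprod (RtoC 0 :: nil) g))%fps).
  - rewrite iter_tpow_Q. do 3 f_equal. ring.
  - intros g. simpl. unfold fQ. rewrite fconst_opp.
    transitivity ((tpow (-(1)) * tpow 1) * fD g)%fps.
    + rewrite tpow_add. replace (-(1) + 1) with (RtoC 0) by ring. rewrite tpow_zero. ring.
    + ring.
Qed.

(** The derivation [d/dy] for [y = 1 - t^mu], as [dy/dx = mu t^(mu - 1)]. *)
Definition fDy (mu : C) (f : fps) : fps := (fconst (/ mu) * tpow (1 - mu) * fD f)%fps.

Lemma iter_fDy mu e f :
  Nat.iter e (fDy mu) f
  = (fconst (Cpow (- / mu) e) *
     (tpow (- (INR e * mu)) * Qprod (lrep (RtoC 0 :: nil) (- mu) e) f))%fps.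
Proof.
  rewrite (iter_ext _ _ (fun g => fconst (- / mu) * (tpow (- mu) * Qprod (RtoC 0 :: nil) g))%fps).
  - rewrite iter_tpow_Q. do 3 f_equal. ring.
  - intros g. simpl. unfold fQ, fDy. rewrite fconst_opp.
    transitivity (fconst (/ mu) * ((tpow (- mu) * tpow 1) * fD g))%fps.
    + rewrite tpow_add. replace (- mu + 1) with (1 - mu) by ring. ring.
    + ring.
Qed.

(** For natural [e], all operators are products of powers of [t] and factors [Q - r].
    Moving the powers of [t] to the left, both sides become the same constant times
    [t^(- M e)] times the product of [Q - r] over [r = 0, ..., M e - 1]; the last
    hypothesis says that the exponents on the left are these.  [sg] is the sign of the
    integer [mu], and [be1], [be2] are the weights on the two sides of a derivative in [y]. *)
Lemma fD_factor mu sg be1 be2 M e f :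
  mu = INR M * sg ->
  be1 + be2 - INR e * mu = - sg ->
  (forall l i, (l < e)%nat -> (i < M)%nat ->
     exists l' j, (l' < e)%nat /\ (j < M)%nat /\
       INR l' * mu - be2 + INR j * sg = INR (M * l + i)) ->
  (tpow (mu - INR (M * e)) *
     Nat.iter M (fun g => tpow be1 * Nat.iter e (fDy mu) (tpow be2 * g)) f)%fps
  = (fconst (Cpow (/ mu) (M * e)) * Nat.iter (M * e) fD f)%fps.
Proof.
  intros Hmu Hbe Hroots.
  set (L := lshift be2 (lrep (RtoC 0 :: nil) (- mu) e)).
  rewrite (iter_ext _ _ (fun g => fconst (Cpow (- / mu) e) * (tpow (- sg) * Qprod L g))%fps).
  2:{ intros g. rewrite iter_fDy, Qprod_tpow. fold L. rewrite <- Hbe.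
      replace (be1 + be2 - INR e * mu) with (be1 + (- (INR e * mu) + be2)) by ring.
      rewrite <- !tpow_add. ring. }
  rewrite iter_tpow_Q, iter_fD.
  rewrite (Qprod_perm (lrep (RtoC 0 :: nil) (-(1)) (M * e)) (lrep L (- sg) M)).
  2:{ apply roots_perm.
      - unfold L, lshift. rewrite length_map, length_lrep. simpl. lia.
      - intros l i Hl Hi. destruct (Hroots l i Hl Hi) as (l' & j & Hl' & Hj & E).
        exists (0 - INR l' * (- mu) - be2), j. split; [|split; [exact Hj|]].
        + unfold L, lshift. apply (in_map (fun r => r - be2)), in_lrep; [exact Hl'|].
          now left.
        + rewrite <- E. ring. }
  rewrite <- Cpow_mult_r, (Nat.mul_comm e M).
  replace (- / mu) with (-(1) * / mu) by ring. rewrite Cpow_mult_l, fconst_mul.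
  replace (- INR (M * e)) with ((mu - INR (M * e)) + INR M * (- sg))
    by (rewrite Hmu at 1; ring).
  rewrite <- tpow_add. ring.
Qed.

(** * Hypergeometrization of formal series *)

Definition fhyp (a c : C) (f : fps) : fps := fun n => f n * (poch a n / poch c n).

Lemma poch_add z n k : poch z (n + k) = poch z n * poch (z + INR n) k.
Proof.
  induction k as [|k IH]; [rewrite Nat.add_0_r; simpl; ring|].
  rewrite Nat.add_succ_r. simpl. rewrite IH, plus_INR, RtoC_plus. ring.
Qed.

Lemma poch_neq0 z n : permissible z -> poch z n <> 0.
Proof.
  intros H; induction n as [|n IH]; simpl.
  - intros E; now apply RtoC_inj, R1_neq_R0 in E.
  - apply Cmult_neq_0; [exact IH|]. intros E. apply (H n).
    transitivity (z + INR n - INR n); [ring | rewrite E; ring].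
Qed.

Lemma permissible_INR_S n : permissible (INR (S n)).
Proof.
  intros k E. rewrite <- RtoC_opp in E. apply RtoC_inj in E.
  pose proof (pos_INR k). rewrite S_INR in E. pose proof (pos_INR n). lra.
Qed.

Lemma fX_pow_low N f n : (n < N)%nat -> (fpow fX N * f)%fps n = 0.
Proof.
  revert n; induction N as [|N IH]; intros n H; [lia|].
  simpl fpow. rewrite <- fmul_assoc. destruct n as [|n].
  - apply fX_mul_0.
  - rewrite fX_mul_S. apply IH. lia.
Qed.

Lemma fX_pow_shift N f n : (fpow fX N * f)%fps (N + n)%nat = f n.
Proof.
  induction N as [|N IH]; simpl fpow.
  - rewrite fmul_const. simpl. ring.
  - rewrite <- fmul_assoc. rewrite Nat.add_succ_l, fX_mul_S. exact IH.
Qed.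

Lemma iter_fD_coef e f n : Nat.iter e fD f n = poch (INR n + 1) e * f (n + e)%nat.
Proof.
  revert n; induction e as [|e IH]; intros n.
  - simpl. rewrite Nat.add_0_r. ring.
  - simpl Nat.iter. unfold fD at 1. rewrite IH.
    change (S e) with (1 + e)%nat at 1. rewrite poch_add. simpl (poch _ 1). simpl (INR 1).
    rewrite RtoC_INR_S. replace (S n + e)%nat with (n + S e)%nat by lia. simpl (INR 0). ring.
Qed.

(** [H_c^(c+e) = ((c)_e)^-1 x^(1-c) (d/dx)^e x^(c+e-1)] with [S c] in place of [c]: on
    [x^n] this is the identity [(c)_e (c+e)_n = (c)_n (c+n)_e]. *)
Lemma fhyp_fD c e f :
  (fconst (poch (INR (S c)) e) * (fpow fX c * fhyp (INR (S c) + INR e) (INR (S c)) f))%fps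
  = Nat.iter e fD (fpow fX (c + e) * f)%fps.
Proof.
  extensionality n. rewrite fmul_const, iter_fD_coef.
  destruct (Nat.lt_ge_cases n c) as [H|H].
  - rewrite !fX_pow_low by lia. ring.
  - replace n with (c + (n - c))%nat by lia. generalize (n - c)%nat; clear n H; intros n.
    rewrite fX_pow_shift. replace (c + n + e)%nat with ((c + e) + n)%nat by lia.
    rewrite fX_pow_shift. unfold fhyp.
    assert (E : poch (INR (S c)) e * poch (INR (S c) + INR e) n
                = poch (INR (S c)) n * poch (INR (c + n) + 1) e).
    { replace (INR (c + n) + 1) with (INR (S c) + INR n)
        by (rewrite RtoC_INR_S, plus_INR, RtoC_plus; ring).
      rewrite <- !poch_add. f_equal. lia. }
    transitivity (poch (INR (S c)) e * poch (INR (S c) + INR e) n * f n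
                  / poch (INR (S c)) n).
    + field. apply poch_neq0, permissible_INR_S.
    + rewrite E. field. apply poch_neq0, permissible_INR_S.
Qed.

Lemma iter_scal (F : fps -> fps) z :
  (forall f, F (fconst z * f)%fps = (fconst z * F f)%fps) ->
  forall n f, Nat.iter n F (fconst z * f)%fps = (fconst z * Nat.iter n F f)%fps.
Proof. intros H n f; induction n as [|n IH]; simpl; [reflexivity | now rewrite IH, H]. Qed.

Fixpoint fprod (A : nat -> fps -> fps) (n : nat) (f : fps) : fps :=
  match n with O => f | S k => fprod A k (A (S k) f) end.

Definition fY (mu : C) : fps := (fconst 1 - tpow mu)%fps.
(** The inverse of [fY mu] for substitution, [1 - (1 - y)^(1/mu)]. *)
Definition fPhi (mu : C) : fps := (fconst 1 - tpow (/ mu))%fps.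
(** The series of [y/(mu x)]. *)
Definition fq (mu : C) : fps := (fconst (/ mu) * ftail (fY mu))%fps.
(** The series of [(mu x/y)^al], written as the power [- al] of [y/(mu x) = 1 - (1 - fq mu)]. *)
Definition hpow (mu al : C) : fps := comp (tpow (- al)) (fconst 1 - fq mu)%fps.

Definition fhyp_wrt (mu a c : C) (f : fps) : fps := comp (fhyp a c (comp f (fPhi mu))) (fY mu).

Lemma fY_0 mu : fY mu O = 0.
Proof. unfold fY, fsub. rewrite tpow_0. simpl. ring. Qed.

Lemma fPhi_0 mu : fPhi mu O = 0.
Proof. unfold fPhi, fsub. rewrite tpow_0. simpl. ring. Qed.

Lemma fY_eq (mu : C) : mu <> 0 -> fY mu = (fconst mu * (fX * fq mu))%fps.
Proof.
  intros H. rewrite (fps_decomp (fY mu)), fY_0. unfold fq.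
  transitivity (fconst (mu * / mu) * (fX * ftail (fY mu)))%fps.
  - rewrite Cinv_r by exact H. ring.
  - rewrite fconst_mul. ring.
Qed.

Lemma tpow_coef1 al : tpow al 1%nat = - al.
Proof. unfold tpow. simpl. field. Qed.

Lemma one_sub_fq_0 (mu : C) : mu <> 0 -> (fconst 1 - fq mu)%fps O = 0.
Proof.
  intros H. unfold fsub, fq. rewrite fmul_const. unfold ftail, fY, fsub.
  rewrite tpow_coef1. simpl. field. exact H.
Qed.

Lemma hpow_add (mu al be : C) : mu <> 0 -> (hpow mu al * hpow mu be)%fps = hpow mu (al + be).
Proof.
  intros H. unfold hpow. rewrite <- comp_mul, tpow_add by now apply one_sub_fq_0.
  do 2 f_equal. ring.
Qed.

Lemma hpow_opp_INR (mu : C) n : mu <> 0 -> hpow mu (- INR n) = fpow (fq mu) n.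
Proof.
  intros H. unfold hpow. replace (- - INR n) with (INR n * 1) by ring.
  pose proof (one_sub_fq_0 mu H) as H0.
  rewrite <- fpow_tpow, comp_pow by exact H0. f_equal.
  rewrite tpow_one. replace (fconst 1 - fX)%fps with (fconst 1 + fconst (-(1)) * fX)%fps
    by (rewrite fconst_opp; ring).
  rewrite comp_add, comp_scal, comp_const, comp_fX, fconst_opp by exact H0. ring.
Qed.

Lemma hpow_INR (mu : C) n : mu <> 0 -> (fpow (fq mu) n * hpow mu (INR n))%fps = fconst 1.
Proof.
  intros H. rewrite <- hpow_opp_INR, hpow_add by exact H.
  replace (- INR n + INR n) with (RtoC 0) by ring.
  unfold hpow. replace (- 0) with (RtoC 0) by ring. rewrite tpow_zero.
  apply comp_const. now apply one_sub_fq_0.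
Qed.

Lemma fD_fY mu : fD (fY mu) = (fconst mu * tpow (mu - 1))%fps.
Proof.
  unfold fY. replace (fconst 1 - tpow mu)%fps with (fconst 1 + fconst (-(1)) * tpow mu)%fps
    by (rewrite fconst_opp; ring).
  rewrite fD_add, fD_scal, fD_const, fD_tpow, fconst_opp. ring.
Qed.

Lemma comp_fD (mu : C) g : mu <> 0 -> comp (fD g) (fY mu) = fDy mu (comp g (fY mu)).
Proof.
  intros H. unfold fDy. rewrite fD_comp, fD_fY by apply fY_0.
  transitivity (fconst (mu * / mu) * (tpow (1 - mu) * tpow (mu - 1)) * comp (fD g) (fY mu))%fps.
  - rewrite tpow_add, Cinv_r by exact H. replace (1 - mu + (mu - 1)) with (RtoC 0) by ring.
    rewrite tpow_zero. ring.
  - rewrite fconst_mul. ring.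
Qed.

Lemma comp_iter_fD (mu : C) e g :
  mu <> 0 -> comp (Nat.iter e fD g) (fY mu) = Nat.iter e (fDy mu) (comp g (fY mu)).
Proof.
  intros H; induction e as [|e IH]; simpl; [reflexivity|].
  now rewrite comp_fD, IH.
Qed.

Definition fhyp_step (mu be1 be2 c d : C) (j : nat) (f : fps) : fps :=
  (tpow be1 * fhyp_wrt mu (c + INR j * d) (c + (INR j - 1) * d) (tpow be2 * f))%fps.

(** The right-hand side of the theorem, with [M = |m|] and [d = (a - c)/M].  For [m > 0]
    the factors of the product carry their weight [t^be1] on the left; for [m < 0] they are
    inverses, whose weight [t^be2] is on the right. *)
Definition frhs (mu be1 be2 : C) (M : nat) (c d : C) (f : fps) : fps :=
  (hpow mu (1 - c) * (tpow (mu - INR M * d) *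
     fprod (fhyp_step mu be1 be2 c d) M (hpow mu (c + INR M * d - 1) * f)))%fps.

(** * Integer parameters *)

Section IntegerParameters.
Variables (mu : C) (mu_neq0 : mu <> 0).
Hypothesis fPhi_fY : forall f, comp (comp f (fPhi mu)) (fY mu) = f.

Lemma fhyp_wrt_fDy b e f :
  (fconst (poch (INR (S b)) e) *
     (fpow (fY mu) b * fhyp_wrt mu (INR (S b) + INR e) (INR (S b)) f))%fps
  = Nat.iter e (fDy mu) (fpow (fY mu) (b + e) * f)%fps.
Proof.
  unfold fhyp_wrt. set (g := comp f (fPhi mu)).
  pose proof (fY_0 mu) as Y0.
  assert (E : comp (fconst (poch (INR (S b)) e) *
      (fpow fX b * fhyp (INR (S b) + INR e) (INR (S b)) g))%fps (fY mu)
    = comp (Nat.iter e fD (fpow fX (b + e) * g)%fps) (fY mu)) by now rewrite fhyp_fD.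
  rewrite comp_scal, comp_mul, comp_pow, comp_fX, comp_iter_fD, comp_mul, comp_pow,
    comp_fX in E by assumption.
  rewrite E. unfold g. now rewrite fPhi_fY.
Qed.

(** Each factor contributes [y^(1-b) (d/dy)^e y^(b+e-1)], where [b] increases by [e] from
    one factor to the next, so that the inner powers of [y] cancel. *)
Lemma fprod_fDy be1 be2 c e n f :
  (fconst (poch (INR (S c)) (n * e)) *
    (fpow (fY mu) c * fprod (fhyp_step mu be1 be2 (INR (S c)) (INR e)) n f))%fps
  = Nat.iter n (fun g => tpow be1 * Nat.iter e (fDy mu) (tpow be2 * g))%fps
      (fpow (fY mu) (c + n * e) * f)%fps.
Proof.
  revert f; induction n as [|n IH]; intros f.
  - simpl. rewrite Nat.add_0_r. ring.
  - cbn [fprod].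
    set (B := fun g => (tpow be1 * Nat.iter e (fDy mu) (tpow be2 * g))%fps) in *.
    rewrite Nat.iter_succ_r.
    assert (BZ : forall z g, B (fconst z * g)%fps = (fconst z * B g)%fps).
    { intros z g. unfold B.
      replace (tpow be2 * (fconst z * g))%fps with (fconst z * (tpow be2 * g))%fps by ring.
      rewrite iter_scal; [ring|]. intros h. unfold fDy. rewrite fD_scal. ring. }
    assert (E : (fconst (poch (INR (S (c + n * e))) e) * (fpow (fY mu) (c + n * e) *
        fhyp_step mu be1 be2 (INR (S c)) (INR e) (S n) f))%fps
      = B (fpow (fY mu) (c + S n * e) * f)%fps).
    { unfold fhyp_step, B.
      replace (INR (S c) + INR (S n) * INR e) with (INR (S (c + n * e)) + INR e)
        by (rewrite !RtoC_INR_S, plus_INR, mult_INR, RtoC_plus, RtoC_mult; ring).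
      replace (INR (S c) + (INR (S n) - 1) * INR e) with (RtoC (INR (S (c + n * e))))
        by (rewrite !RtoC_INR_S, plus_INR, mult_INR, RtoC_plus, RtoC_mult; ring).
      replace (c + S n * e)%nat with (c + n * e + e)%nat by lia.
      replace (tpow be2 * (fpow (fY mu) (c + n * e + e) * f))%fps
        with (fpow (fY mu) (c + n * e + e) * (tpow be2 * f))%fps by ring.
      rewrite <- fhyp_wrt_fDy. ring. }
    rewrite <- E, iter_scal by apply BZ.
    rewrite <- IH. replace (S n * e)%nat with (n * e + e)%nat by lia.
    rewrite poch_add, fconst_mul.
    replace (INR (S c) + INR (n * e)) with (RtoC (INR (S (c + n * e))))
      by (rewrite !RtoC_INR_S, plus_INR, RtoC_plus; ring).
    ring.
Qed.

(** After multiplication by [x^(c-1)], both sides are constants times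
    [(d/dx)^(M e) (x^(a-1) f)]: the outer powers of [mu x/y] turn powers of [x] into powers
    of [y], [fprod_fDy] turns the product into derivatives in [y], and [fD_factor] turns
    these into derivatives in [x]. *)
Lemma frhs_integer sg be1 be2 M c e f :
  mu = INR M * sg ->
  be1 + be2 - INR e * mu = - sg ->
  (forall l i, (l < e)%nat -> (i < M)%nat ->
     exists l' j, (l' < e)%nat /\ (j < M)%nat /\
       INR l' * mu - be2 + INR j * sg = INR (M * l + i)) ->
  frhs mu be1 be2 M (INR (S c)) (INR e) f
  = fhyp (INR (S c) + INR M * INR e) (INR (S c)) f.
Proof.
  intros Hmu Hbe Hroots.
  set (K := poch (INR (S c)) (M * e)).
  assert (HK : K * Cpow mu c <> 0).
  { apply Cmult_neq_0; [apply poch_neq0, permissible_INR_S | now apply Cpow_nz]. }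
  apply (fX_pow_cancel c).
  assert (E : (fconst (K * Cpow mu c) * (fpow fX c * frhs mu be1 be2 M (INR (S c)) (INR e) f)
     = fconst (K * Cpow mu c) *
        (fpow fX c * fhyp (INR (S c) + INR M * INR e) (INR (S c)) f))%fps).
  2:{ transitivity (fconst (/ (K * Cpow mu c)) * (fconst (K * Cpow mu c) *
        (fpow fX c * frhs mu be1 be2 M (INR (S c)) (INR e) f)))%fps;
      [|rewrite E]; rewrite !fmul_assoc, <- (fconst_mul (/ _)), Cinv_l by exact HK; ring. }
  rewrite !fconst_mul, <- fpow_const. unfold frhs.
  replace (1 - INR (S c)) with (- INR c) by (rewrite RtoC_INR_S; ring).
  replace (INR (S c) + INR M * INR e - 1) with (RtoC (INR (c + M * e)))
    by (rewrite RtoC_INR_S, plus_INR, mult_INR, RtoC_plus, RtoC_mult; ring).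
  rewrite hpow_opp_INR by exact mu_neq0.
  set (P := fprod _ _ _).
  transitivity (tpow (mu - INR M * INR e) * (fconst K *
    (fpow (fconst mu * (fX * fq mu)) c * P)))%fps; [rewrite !fpow_mul; ring|].
  rewrite <- fY_eq by exact mu_neq0. unfold P, K. rewrite fprod_fDy.
  replace (fpow (fY mu) (c + M * e) * (hpow mu (INR (c + M * e)) * f))%fps
    with (fconst (Cpow mu (c + M * e)) * (fpow fX (c + M * e) * f))%fps.
  2:{ rewrite (fY_eq mu), !fpow_mul, fpow_const by exact mu_neq0.
      transitivity (fconst (Cpow mu (c + M * e)) * (fpow fX (c + M * e) *
         (fpow (fq mu) (c + M * e) * hpow mu (INR (c + M * e)))) * f)%fps; [|ring].
      rewrite hpow_INR by exact mu_neq0. ring. }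
  rewrite iter_scal.
  2:{ intros h. replace (tpow be2 * (fconst (Cpow mu (c + M * e)) * h))%fps
        with (fconst (Cpow mu (c + M * e)) * (tpow be2 * h))%fps by ring.
      rewrite iter_scal; [ring|]. intros h'. unfold fDy. rewrite fD_scal. ring. }
  replace (INR M * INR e) with (RtoC (INR (M * e)))
    by (rewrite mult_INR, RtoC_mult; reflexivity).
  transitivity (fconst (Cpow mu (c + M * e)) * (tpow (mu - INR (M * e)) *
     Nat.iter M (fun g => tpow be1 * Nat.iter e (fDy mu) (tpow be2 * g))
       (fpow fX (c + M * e) * f)))%fps; [ring|].
  rewrite (fD_factor mu sg be1 be2 M e) by assumption.
  transitivity (fpow (fconst mu) c * (fconst (poch (INR (S c)) (M * e)) *
     (fpow fX c * fhyp (INR (S c) + INR (M * e)) (INR (S c)) f)))%fps; [|ring].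
  rewrite fhyp_fD, fpow_const, Cpow_add_r, fconst_mul.
  transitivity (fconst (Cpow mu c) * fconst (Cpow mu (M * e) * Cpow (/ mu) (M * e)) *
    Nat.iter (M * e) fD (fpow fX (c + M * e) * f))%fps;
   [rewrite fconst_mul; ring | rewrite <- Cpow_mult_l, Cinv_r, Cpow_1_l by exact mu_neq0; ring].
Qed.

End IntegerParameters.

(** * Rational dependence on the parameters *)

Fixpoint peval (p : list C) (z : C) : C :=
  match p with nil => RtoC 0 | a :: p' => a + z * peval p' z end.

Lemma peval_factor p (r : C) : exists q, length q = pred (length p) /\
  forall z, peval p z = peval p r + (z - r) * peval q z.
Proof.
  induction p as [|a p (q & Hq & E)].
  - exists nil. split; [reflexivity|]. intros z. simpl. ring.
  - destruct p as [|b p].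
    + exists nil. split; [reflexivity|]. intros z; simpl; ring.
    + exists (peval (b :: p) r :: q). split; [simpl in *; lia|].
      intros z. change (peval (a :: b :: p) z) with (a + z * peval (b :: p) z).
      change (peval (a :: b :: p) r) with (a + r * peval (b :: p) r).
      rewrite (E z). simpl. ring.
Qed.

(** A root [N] splits off a factor [z - N]; the quotient has smaller degree and vanishes at
    all later natural numbers. *)
Lemma peval_zero p N :
  (forall n, (N <= n)%nat -> peval p (INR n) = 0) -> forall z, peval p z = 0.
Proof.
  remember (length p) as n eqn:Hn.
  revert N p Hn; induction n as [|n IH]; intros N p Hn H z.
  - destruct p; [reflexivity | discriminate].
  - destruct (peval_factor p (INR N)) as (q & Hq & E).
    rewrite <- Hn in Hq. simpl in Hq.
    assert (H0 := H N (le_n N)).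
    rewrite E, H0, (IH (S N) q); [ring | now symmetry |].
    intros k Hk. assert (Hk0 := H k ltac:(lia)). rewrite E, H0 in Hk0.
    assert (Hne : RtoC (INR k) - INR N <> 0).
    { intros E'. apply (Nat.lt_irrefl N).
      replace N with k at 2; [lia|]. apply INR_eq, RtoC_inj.
      transitivity (RtoC (INR k) - INR N + INR N); [ring | rewrite E'; ring]. }
    transitivity (/ (INR k - INR N) * (0 + (INR k - INR N) * peval q (INR k))).
    + field. exact Hne.
    + rewrite Hk0. ring.
Qed.

Lemma peval_add p q : exists s, forall z, peval s z = peval p z + peval q z.
Proof.
  revert q; induction p as [|a p IH]; intros q.
  - exists q. intros z; simpl; ring.
  - destruct q as [|b q].
    + exists (a :: p). intros z; simpl; ring.
    + destruct (IH q) as (s & Es). exists (a + b :: s). intros z; simpl. rewrite Es. ring.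
Qed.

Lemma peval_mul p q : exists s, forall z, peval s z = peval p z * peval q z.
Proof.
  induction p as [|a p (s & Es)].
  - exists nil. intros z; simpl; ring.
  - destruct (peval_add (map (Cmult a) q) (RtoC 0 :: s)) as (t & Ht).
    exists t. intros z. rewrite Ht. simpl. rewrite Es.
    replace (peval (map (Cmult a) q) z) with (a * peval q z); [ring|].
    clear. induction q as [|b q IH]; simpl; [ring | rewrite <- IH; ring].
Qed.

(** [phi] agrees on [G] with a quotient of polynomials whose denominator has no zero on
    [G]; multiplied out so that the definition contains no division. *)
Definition rational (G : C -> Prop) (phi : C -> C) : Prop :=
  exists P Q, forall z, G z -> peval Q z <> 0 /\ peval Q z * phi z = peval P z.

Section Rational.
Variable G : C -> Prop.

Lemma C1_neq0 : RtoC 1 <> 0.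
Proof. intros E. now apply RtoC_inj, R1_neq_R0 in E. Qed.

Lemma rational_const (w : C) : rational G (fun _ => w).
Proof.
  exists (w :: nil), (RtoC 1 :: nil). intros z _. simpl. split; [|ring].
  replace (1 + z * 0) with (RtoC 1) by ring. apply C1_neq0.
Qed.

Lemma rational_id : rational G (fun z => z).
Proof.
  exists (RtoC 0 :: RtoC 1 :: nil), (RtoC 1 :: nil). intros z _. simpl. split; [|ring].
  replace (1 + z * 0) with (RtoC 1) by ring. apply C1_neq0.
Qed.

Lemma rational_mul phi psi :
  rational G phi -> rational G psi -> rational G (fun z => phi z * psi z).
Proof.
  intros (P & Q & H) (P' & Q' & H').
  destruct (peval_mul P P') as (P2 & E1), (peval_mul Q Q') as (Q2 & E2).
  exists P2, Q2. intros z Hz. destruct (H z Hz) as (N & E), (H' z Hz) as (N' & E').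
  rewrite E1, E2, <- E, <- E'. split; [now apply Cmult_neq_0 | ring].
Qed.

Lemma rational_add phi psi :
  rational G phi -> rational G psi -> rational G (fun z => phi z + psi z).
Proof.
  intros (P & Q & H) (P' & Q' & H').
  destruct (peval_mul P Q') as (A & EA), (peval_mul P' Q) as (B & EB).
  destruct (peval_add A B) as (P2 & E1), (peval_mul Q Q') as (Q2 & E2).
  exists P2, Q2. intros z Hz. destruct (H z Hz) as (N & E), (H' z Hz) as (N' & E').
  rewrite E1, E2, EA, EB, <- E, <- E'. split; [now apply Cmult_neq_0 | ring].
Qed.

Lemma rational_inv phi :
  rational G phi -> (forall z, G z -> phi z <> 0) -> rational G (fun z => / phi z).
Proof.
  intros (P & Q & H) Hne. exists Q, P. intros z Hz.
  destruct (H z Hz) as (N & E). rewrite <- E. split.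
  - apply Cmult_neq_0; [exact N | now apply Hne].
  - field. now apply Hne.
Qed.

Lemma rational_zero phi N :
  rational G phi -> (forall n, (N <= n)%nat -> G (INR n) /\ phi (INR n) = 0) ->
  forall z, G z -> phi z = 0.
Proof.
  intros (P & Q & H) Hn z Hz. destruct (H z Hz) as (NQ & E).
  rewrite (peval_zero P N) in E.
  - transitivity (/ peval Q z * (peval Q z * phi z)); [field; exact NQ | rewrite E; ring].
  - intros n Hge. destruct (Hn n Hge) as (HG & E0).
    destruct (H _ HG) as (_ & <-). rewrite E0. ring.
Qed.

Lemma rational_poch phi n : rational G phi -> rational G (fun z => poch (phi z) n).
Proof.
  intros H; induction n as [|n IH]; simpl.
  - apply rational_const.
  - apply rational_mul; [exact IH|]. apply rational_add; [exact H | apply rational_const].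
Qed.

Definition frational (F : C -> fps) : Prop := forall n, rational G (fun z => F z n).

Lemma frational_cst f : frational (fun _ => f).
Proof. intros n. apply rational_const. Qed.

Lemma frational_const phi : rational G phi -> frational (fun z => fconst (phi z)).
Proof. intros H [|n]; [exact H | apply (rational_const 0)]. Qed.

Lemma frational_add F F' :
  frational F -> frational F' -> frational (fun z => F z + F' z)%fps.
Proof. intros H H' n. apply rational_add; [apply H | apply H']. Qed.

Lemma frational_mul F F' :
  frational F -> frational F' -> frational (fun z => F z * F' z)%fps.
Proof.
  intros H H' n. revert F H; induction n as [|n IH]; intros F H.
  - apply (rational_mul (fun z => F z O) (fun z => F' z O)); [apply H | apply H'].
  - apply (rational_add (fun z => F z O * F' z (S n)) (fun z => (ftail (F z) * F' z)%fps n)).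
    + apply rational_mul; [apply H | apply H'].
    + apply (IH (fun z => ftail (F z))). intros k. apply (H (S k)).
Qed.

Lemma frational_comp F y : frational F -> frational (fun z => comp (F z) y).
Proof.
  intros H n. unfold comp.
  assert (E : forall N F, frational F -> frational (fun z => comp_fuel N (F z) y)).
  { clear. induction N as [|N IH]; intros F H; simpl.
    - apply frational_const, H.
    - apply frational_add; [apply frational_const, H|].
      apply frational_mul; [apply frational_cst|].
      apply (IH (fun z => ftail (F z))). intros k. apply (H (S k)). }
  apply E, H.
Qed.

Lemma frational_tpow phi : rational G phi -> frational (fun z => tpow (phi z)).
Proof.
  intros H n. unfold tpow, Cdiv.
  apply rational_mul; [|apply rational_const].
  apply rational_poch.
  replace (fun z => - phi z) with (fun z => - (1) * phi z).
  - apply rational_mul; [apply rational_const | exact H].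
  - extensionality z. ring.
Qed.

Lemma frational_fhyp al ga F :
  rational G al -> rational G ga -> (forall z, G z -> permissible (ga z)) ->
  frational F -> frational (fun z => fhyp (al z) (ga z) (F z)).
Proof.
  intros Ha Hg Hp HF n. unfold fhyp, Cdiv.
  apply rational_mul; [apply HF|].
  apply rational_mul; [now apply rational_poch|].
  apply rational_inv; [now apply rational_poch|].
  intros z Hz. apply poch_neq0, Hp, Hz.
Qed.

Lemma frational_frhs mu be1 be2 M ga de f :
  rational G be1 -> rational G be2 -> rational G ga -> rational G de ->
  (forall z j, G z -> (j < M)%nat -> permissible (ga z + INR j * de z)) ->
  frational (fun z => frhs mu (be1 z) (be2 z) M (ga z) (de z) f).
Proof.
  intros H1 H2 Hg Hd Hp.
  assert (lin : forall u : C, rational G (fun z => ga z + u * de z)).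
  { intros u. apply rational_add; [exact Hg|].
    apply rational_mul; [apply rational_const | exact Hd]. }
  assert (opp : forall phi, rational G phi -> rational G (fun z => - phi z)).
  { intros phi H. replace (fun z => - phi z) with (fun z => - (1) * phi z).
    - apply rational_mul; [apply rational_const | exact H].
    - extensionality z. ring. }
  assert (pw : forall phi, rational G phi -> frational (fun z => hpow mu (phi z))).
  { intros phi H. unfold hpow. apply frational_comp, frational_tpow, opp, H. }
  unfold frhs. apply frational_mul; [|apply frational_mul].
  - apply pw. unfold Cminus. apply rational_add; [apply rational_const | now apply opp].
  - apply frational_tpow. unfold Cminus. apply rational_add; [apply rational_const|].
    apply opp. apply rational_mul; [apply rational_const | exact Hd].
  - assert (prod : forall F0, frational F0 ->
      frational (fun z => fprod (fhyp_step mu (be1 z) (be2 z) (ga z) (de z)) M (F0 z))).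
    { clear pw opp. induction M as [|M IH]; intros F0 HF0; simpl; [exact HF0|].
      apply (IH ltac:(intros; apply Hp; [assumption | lia])
        (fun z => fhyp_step mu (be1 z) (be2 z) (ga z) (de z) (S M) (F0 z))).
      unfold fhyp_step. apply frational_mul; [now apply frational_tpow|].
      unfold fhyp_wrt. apply frational_comp, frational_fhyp; [apply lin | apply lin | |].
      - intros z Hz. replace (INR (S M) - 1) with (RtoC (INR M))
          by (rewrite RtoC_INR_S; ring). apply Hp; [exact Hz | lia].
      - apply (frational_comp (fun z => tpow (be2 z) * F0 z)%fps).
        apply frational_mul; [now apply frational_tpow | exact HF0]. }
    apply prod, frational_mul; [|apply frational_cst]. apply pw. unfold Cminus.
    apply (rational_add (fun z => ga z + INR M * de z) (fun _ => - (1)));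
      [apply lin | apply rational_const].
Qed.

(** The denominators of the coefficients are Pochhammer symbols of the lower parameters
    [ga + j de] with [j < M], which do not vanish when these are permissible. *)
Lemma frational_defect mu be1 be2 M ga de f :
  (0 < M)%nat ->
  rational G be1 -> rational G be2 -> rational G ga -> rational G de ->
  (forall z j, G z -> (j < M)%nat -> permissible (ga z + INR j * de z)) ->
  frational (fun z =>
    (frhs mu (be1 z) (be2 z) M (ga z) (de z) f - fhyp (ga z + INR M * de z) (ga z) f)%fps).
Proof.
  intros HM H1 H2 Hg Hd Hp.
  replace (fun z =>
    (frhs mu (be1 z) (be2 z) M (ga z) (de z) f - fhyp (ga z + INR M * de z) (ga z) f)%fps)
  with (fun z => (frhs mu (be1 z) (be2 z) M (ga z) (de z) f
      + fconst (-(1)) * fhyp (ga z + INR M * de z) (ga z) f)%fps)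
    by (extensionality z; rewrite fconst_opp; ring).
  apply frational_add; [now apply frational_frhs|].
  apply frational_mul; [apply frational_cst|].
  apply frational_fhyp; [|exact Hg| |apply frational_cst].
  - apply rational_add; [exact Hg|].
    apply rational_mul; [apply rational_const | exact Hd].
  - intros z Hz. replace (ga z) with (ga z + INR 0 * de z) by (simpl; ring).
    now apply Hp.
Qed.

End Rational.

Lemma permissible_add_nat c n : permissible c -> permissible (c + INR n).
Proof.
  intros H k E. apply (H (k + n)%nat). rewrite plus_INR, RtoC_plus.
  transitivity (c + INR n - INR n); [ring | rewrite E; ring].
Qed.

(** Continuation in two steps: for fixed natural [d], in [c] from the positive integers;
    then for fixed [c], in [d] from the natural numbers.  Natural [d] are permissible for
    every permissible [c], so the second step has enough points. *)
Lemma frhs_continuation mu be1 be2 M f :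
  (0 < M)%nat ->
  (forall G, rational G be1) -> (forall G, rational G be2) ->
  (forall c e, frhs mu (be1 (INR e)) (be2 (INR e)) M (INR (S c)) (INR e) f
     = fhyp (INR (S c) + INR M * INR e) (INR (S c)) f) ->
  forall c d, (forall j, (j < M)%nat -> permissible (c + INR j * d)) ->
  frhs mu (be1 d) (be2 d) M c d f = fhyp (c + INR M * d) c f.
Proof.
  intros HM H1 H2 Hint.
  assert (perm_nat : forall c j e, permissible c -> permissible (c + INR j * INR e)).
  { intros c j e Hc. rewrite <- RtoC_mult, <- mult_INR. now apply permissible_add_nat. }
  assert (Hint_d : forall c e, permissible c ->
    frhs mu (be1 (INR e)) (be2 (INR e)) M c (INR e) f = fhyp (c + INR M * INR e) c f).
  { intros c e Hc. apply fsub_eq0. extensionality n.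
    transitivity (RtoC 0); [|destruct n; reflexivity].
    revert c Hc.
    apply (rational_zero permissible (fun c =>
      (frhs mu (be1 (INR e)) (be2 (INR e)) M c (INR e) f
        - fhyp (c + INR M * INR e) c f)%fps n) 1).
    - apply (frational_defect permissible mu (fun _ => be1 (INR e)) (fun _ => be2 (INR e))
        M (fun c => c) (fun _ => INR e) f HM);
        try apply rational_const; [apply rational_id|].
      intros c j Hc _. now apply perm_nat.
    - intros [|k] Hk; [lia|]. split; [apply permissible_INR_S|].
      rewrite Hint. unfold fsub. ring. }
  intros c d Hd. apply fsub_eq0. extensionality n.
  transitivity (RtoC 0); [|destruct n; reflexivity].
  assert (Hc : permissible c)
    by (replace c with (c + INR 0 * d) by (simpl; ring); now apply Hd).
  revert d Hd.
  apply (rational_zero (fun d => forall j, (j < M)%nat -> permissible (c + INR j * d))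
    (fun d => (frhs mu (be1 d) (be2 d) M c d f - fhyp (c + INR M * d) c f)%fps n) 0).
  - apply (frational_defect _ mu be1 be2 M (fun _ => c) (fun d => d) f HM);
      [apply H1 | apply H2 | apply rational_const | apply rational_id |].
    intros d j Hd Hj. now apply Hd.
  - intros e _. split; [intros j _; now apply perm_nat|].
    rewrite Hint_d by exact Hc. unfold fsub. ring.
Qed.

Lemma INR_pos_neq0 M : (0 < M)%nat -> RtoC (INR M) <> 0.
Proof. intros H E. apply RtoC_inj in E. apply (not_0_INR M); [lia | exact E]. Qed.

Lemma Copp_neq0 (z : C) : z <> 0 -> - z <> 0.
Proof. intros H E. apply H. transitivity (- - z); [ring | rewrite E; ring]. Qed.

Lemma frhs_pos M c d f :
  (0 < M)%nat ->
  (forall g, comp (comp g (fPhi (INR M))) (fY (INR M)) = g) ->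
  (forall j, (j < M)%nat -> permissible (c + INR j * d)) ->
  frhs (INR M) (INR M * d - 1) 0 M c d f = fhyp (c + INR M * d) c f.
Proof.
  intros HM Hinv Hp.
  apply (frhs_continuation (INR M) (fun d => INR M * d - 1) (fun _ => RtoC 0));
    [exact HM | | intros; apply rational_const | | exact Hp].
  - intros G. unfold Cminus. apply rational_add; [|apply rational_const].
    apply rational_mul; [apply rational_const | apply rational_id].
  - intros n e. apply (frhs_integer _ (INR_pos_neq0 M HM) Hinv 1).
    + ring.
    + ring.
    + intros l i Hl Hi. exists l, i. split; [exact Hl|]. split; [exact Hi|].
      rewrite plus_INR, mult_INR, RtoC_plus, RtoC_mult. ring.
Qed.

Lemma frhs_neg M c d f :
  (0 < M)%nat ->
  (forall g, comp (comp g (fPhi (- INR M))) (fY (- INR M)) = g) ->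
  (forall j, (j < M)%nat -> permissible (c + INR j * d)) ->
  frhs (- INR M) 0 (1 - INR M * d) M c d f = fhyp (c + INR M * d) c f.
Proof.
  intros HM Hinv Hp.
  apply (frhs_continuation (- INR M) (fun _ => RtoC 0) (fun d => 1 - INR M * d));
    [exact HM | intros; apply rational_const | | | exact Hp].
  - intros G. replace (fun d => 1 - INR M * d) with (fun d => 1 + - INR M * d)
      by (extensionality z; ring).
    apply rational_add; [apply rational_const|].
    apply rational_mul; [apply rational_const | apply rational_id].
  - intros n e. apply (frhs_integer _ (Copp_neq0 _ (INR_pos_neq0 M HM)) Hinv (-(1))).
    + ring.
    + ring.
    (* for negative [mu] the exponents are met in decreasing order *)
    + intros l i Hl Hi. exists (e - 1 - l)%nat, (M - 1 - i)%nat.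
      split; [lia|]. split; [lia|].
      rewrite plus_INR, mult_INR, !minus_INR by lia.
      rewrite RtoC_plus, !RtoC_minus, RtoC_mult. simpl (INR 1). ring.
Qed.

(** * Limits and partial sums *)

Definition clim (u : nat -> C) (l : C) : Prop :=
  forall eps : R, (0 < eps)%R -> exists N, forall n, (N <= n)%nat -> (Cmod (u n - l) < eps)%R.

Lemma Cmod_sub_sym z w : Cmod (z - w) = Cmod (w - z).
Proof. rewrite <- Cmod_opp. f_equal. ring. Qed.

Lemma Rle_eps_eq0 (d : R) : (0 <= d)%R -> (forall eps, 0 < eps -> d < eps)%R -> d = 0%R.
Proof. intros H0 H. destruct (Rle_lt_or_eq_dec _ _ H0) as [H1|H1]; [|easy].
  specialize (H d H1). lra. Qed.

Lemma clim_unique u l l' : clim u l -> clim u l' -> l = l'.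
Proof.
  intros H H'.
  assert (E : Cmod (l - l') = 0%R).
  { apply Rle_eps_eq0; [apply Cmod_ge_0|]. intros eps He.
    destruct (H (eps / 2)%R ltac:(lra)) as (N & HN), (H' (eps / 2)%R ltac:(lra)) as (N' & HN').
    specialize (HN (N + N')%nat ltac:(lia)). specialize (HN' (N + N')%nat ltac:(lia)).
    replace (l - l') with ((l - u (N + N')%nat) + (u (N + N')%nat - l')) by ring.
    eapply Rle_lt_trans; [apply Cmod_triangle|]. rewrite (Cmod_sub_sym l). lra. }
  apply Cmod_eq_0 in E. transitivity (l - l' + l'); [ring | rewrite E; ring].
Qed.

Lemma clim_add u v l l' : clim u l -> clim v l' -> clim (fun n => u n + v n) (l + l').
Proof.
  intros H H' eps He.
  destruct (H (eps / 2)%R ltac:(lra)) as (N & HN), (H' (eps / 2)%R ltac:(lra)) as (N' & HN').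
  exists (N + N')%nat. intros n Hn.
  specialize (HN n ltac:(lia)). specialize (HN' n ltac:(lia)).
  replace (u n + v n - (l + l')) with ((u n - l) + (v n - l')) by ring.
  eapply Rle_lt_trans; [apply Cmod_triangle|]. lra.
Qed.

Lemma clim_const z : clim (fun _ => z) z.
Proof.
  intros eps He. exists 0%nat. intros n _. replace (z - z) with (RtoC 0) by ring.
  now rewrite Cmod_0.
Qed.

Lemma clim_scal z u l : clim u l -> clim (fun n => z * u n) (z * l).
Proof.
  intros H eps He. pose proof (Cmod_ge_0 z) as Hz.
  destruct (H (eps / (Cmod z + 1))%R) as (N & HN); [apply Rdiv_lt_0_compat; lra|].
  exists N. intros n Hn. specialize (HN n Hn).
  replace (z * u n - z * l) with (z * (u n - l)) by ring. rewrite Cmod_mult.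
  apply Rle_lt_trans with (Cmod z * (eps / (Cmod z + 1)))%R.
  - apply Rmult_le_compat_l; lra.
  - apply Rmult_lt_reg_r with (Cmod z + 1)%R; [lra|]. field_simplify; lra.
Qed.

Lemma clim_of_S u l : clim (fun n => u (S n)) l -> clim u l.
Proof.
  intros H eps He. destruct (H eps He) as (N & HN). exists (S N). intros [|n] Hn; [lia|].
  apply HN. lia.
Qed.

Lemma clim_le u l M : clim u l -> (forall n, Cmod (u n) <= M)%R -> (Cmod l <= M)%R.
Proof.
  intros H HM. apply Rnot_lt_le. intros Hlt.
  destruct (H (Cmod l - M)%R ltac:(lra)) as (N & HN). specialize (HN N (le_n N)).
  specialize (HM N). pose proof (Cmod_triangle (l - u N) (u N)) as Ht.
  replace (l - u N + u N) with l in Ht by ring. rewrite Cmod_sub_sym in Ht. lra.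
Qed.

Lemma clim_Cauchy (u : nat -> C) :
  (forall eps : R, (0 < eps)%R -> exists N, forall n m, (N <= n)%nat -> (N <= m)%nat ->
     (Cmod (u n - u m) < eps)%R) -> exists l, clim u l.
Proof.
  intros H.
  assert (part : forall p : C -> R, (forall z w, p (z - w) = (p z - p w)%R) ->
    (forall z, Rabs (p z) <= Cmod z)%R -> exists l, Un_cv (fun n => p (u n)) l).
  { intros p Hsub Hle. destruct (Rcomplete.R_complete (fun n => p (u n))) as (l & Hl).
    - intros eps He. destruct (H eps He) as (N & HN). exists N. intros n m Hn Hm.
      unfold Rdist. rewrite <- Hsub. eapply Rle_lt_trans; [apply Hle | now apply HN].
    - now exists l. }
  destruct (part Re) as (a & Ha); [reflexivity | apply re_le_Cmod |].
  destruct (part Im) as (b & Hb); [reflexivity | |].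
  { intros z. eapply Rle_trans; [|apply Rmax_Cmod]. apply Rmax_r. }
  exists (a, b). intros eps He.
  destruct (Ha (eps / 2)%R ltac:(lra)) as (N & HN), (Hb (eps / 2)%R ltac:(lra)) as (N' & HN').
  exists (N + N')%nat. intros n Hn.
  specialize (HN n ltac:(lia)). specialize (HN' n ltac:(lia)). unfold Rdist in *.
  replace (u n - (a, b)) with (RtoC (Re (u n) - a) + Ci * RtoC (Im (u n) - b)).
  2:{ destruct (u n) as (p, q). unfold Ci, Cminus, Cplus, Cmult, Copp, RtoC; simpl.
      f_equal; ring. }
  eapply Rle_lt_trans; [apply Cmod_triangle|].
  rewrite Cmod_mult, Cmod_Ci, !Cmod_R. lra.
Qed.

(** Horner form: [psumn] and [absn] obey the recursion [a = a 0 + x * ftail a], on which the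
    evaluation of products and composites rests. *)
Fixpoint psumn (n : nat) (a : fps) (x : C) : C :=
  match n with O => a O | S k => a O + x * psumn k (ftail a) x end.

Fixpoint absn (n : nat) (a : fps) (r : R) : R :=
  match n with O => Cmod (a O) | S k => (Cmod (a O) + r * absn k (ftail a) r)%R end.

Lemma psumn_S n a x : psumn (S n) a x = psumn n a x + Cpow x (S n) * a (S n).
Proof.
  revert a; induction n as [|n IH]; intros a.
  - simpl. unfold ftail. ring.
  - change (psumn (S (S n)) a x) with (a O + x * psumn (S n) (ftail a) x).
    rewrite (IH (ftail a)). simpl. unfold ftail. ring.
Qed.

Lemma absn_S n a r : absn (S n) a r = (absn n a r + r ^ (S n) * Cmod (a (S n)))%R.
Proof.
  revert a; induction n as [|n IH]; intros a.
  - simpl. unfold ftail. ring.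
  - change (absn (S (S n)) a r) with (Cmod (a O) + r * absn (S n) (ftail a) r)%R.
    rewrite (IH (ftail a)). simpl. unfold ftail. ring.
Qed.

Lemma absn_pos n a r : (0 <= r)%R -> (0 <= absn n a r)%R.
Proof.
  intros Hr; revert a; induction n as [|n IH]; intros a; simpl; [apply Cmod_ge_0|].
  pose proof (Cmod_ge_0 (a O)). pose proof (Rmult_le_pos _ _ Hr (IH (ftail a))). lra.
Qed.

Lemma pow_n_Cpow (x : C) n : @pow_n C_Ring x n = Cpow x n.
Proof. induction n as [|n IH]; simpl; [reflexivity | now rewrite IH]. Qed.

Lemma sum_n_psumn (a : fps) (x : C) n :
  sum_n (fun k => scal (pow_n x k) (a k)) n = psumn n a x :> C_NormedModule.
Proof.
  induction n as [|n IH].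
  - rewrite sum_O. simpl. change (scal one (a O)) with (1 * a O). ring.
  - rewrite sum_Sn, psumn_S. refine (f_equal2 Cplus IH _).
    exact (f_equal (fun z => z * a (S n)) (pow_n_Cpow x (S n))).
Qed.

Lemma filterlim_clim (u : nat -> C_NormedModule) (s : C_NormedModule) :
  filterlim u eventually (locally s) <-> clim u s.
Proof.
  etransitivity;
    [apply (@filterlim_locally_ball_norm C_AbsRing nat C_NormedModule eventually _)|].
  split.
  - intros H eps He. exact (H (mkposreal eps He)).
  - intros H eps. exact (H eps (cond_pos eps)).
Qed.

Lemma is_pseries_clim (a : fps) (x s : C) :
  is_pseries a x s <-> clim (fun n => psumn n a x) s.
Proof.
  replace (fun n => psumn n a x) with (fun n : nat =>
    sum_n (fun k => scal (pow_n x k) (a k)) n : C_NormedModule)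
    by (extensionality n; apply sum_n_psumn).
  apply filterlim_clim.
Qed.

Definition near0 (P : C -> Prop) : Prop :=
  exists d : R, (0 < d)%R /\ forall x, (Cmod x < d)%R -> P x.

Lemma locally_near0 P : locally (RtoC 0) P <-> near0 P.
Proof.
  assert (E : forall x : C, @minus C_NormedModule x (RtoC 0) = x).
  { intros x. change (x - 0 = x). ring. }
  split.
  - intros H. apply (@locally_norm_le_locally C_AbsRing C_NormedModule) in H.
    destruct H as (d & Hd). exists d. split; [apply cond_pos|].
    intros x Hx. apply Hd. unfold ball_norm. rewrite E. exact Hx.
  - intros (d & Hd & H).
    apply (@locally_le_locally_norm C_AbsRing C_NormedModule).
    exists (mkposreal d Hd). intros x Hx. apply H. unfold ball_norm in Hx.
    rewrite E in Hx. exact Hx.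
Qed.

Lemma near0_and P Q : near0 P -> near0 Q -> near0 (fun x => P x /\ Q x).
Proof.
  intros (d & Hd & H) (d' & Hd' & H'). exists (Rmin d d'). split; [now apply Rmin_pos|].
  intros x Hx. split; [apply H | apply H'];
    (eapply Rlt_le_trans; [exact Hx|]); [apply Rmin_l | apply Rmin_r].
Qed.

Lemma near0_imp (P Q : C -> Prop) : (forall x, P x -> Q x) -> near0 P -> near0 Q.
Proof. intros H (d & Hd & HP). exists d. split; [exact Hd | auto]. Qed.

Lemma near0_at P : near0 P -> P 0.
Proof. intros (d & Hd & H). apply H. now rewrite Cmod_0. Qed.

(** * Absolutely summable series *)

(** [M] bounds the norm of [a] in the Banach algebra of series that are absolutely
    summable on the disk of radius [r]. *)
Definition bnd (r : R) (a : fps) (M : R) : Prop := forall n, (absn n a r <= M)%R.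

Lemma absn_mono n a r r' : (0 <= r <= r')%R -> (absn n a r <= absn n a r')%R.
Proof.
  intros H; revert a; induction n as [|n IH]; intros a; simpl; [lra|].
  apply Rplus_le_compat_l, Rmult_le_compat; try apply IH; try apply absn_pos; lra.
Qed.

Lemma bnd_mono r r' a M : (0 <= r <= r')%R -> bnd r' a M -> bnd r a M.
Proof. intros H HB n. eapply Rle_trans; [now apply absn_mono | apply HB]. Qed.

Lemma bnd_ftail r a M : (0 < r)%R -> bnd r a M -> bnd r (ftail a) (M / r).
Proof.
  intros Hr H n. specialize (H (S n)). simpl in H. pose proof (Cmod_ge_0 (a O)).
  apply Rmult_le_reg_l with r; [exact Hr|]. replace (r * (M / r))%R with M by (field; lra).
  lra.
Qed.

Lemma bnd_ge0 r a M : bnd r a M -> (0 <= M)%R.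
Proof. intros H. specialize (H O). simpl in H. pose proof (Cmod_ge_0 (a O)). lra. Qed.

Lemma absn_add n a b r : (0 <= r)%R -> (absn n (a + b)%fps r <= absn n a r + absn n b r)%R.
Proof.
  intros Hr; revert a b; induction n as [|n IH]; intros a b; simpl; [apply Cmod_triangle|].
  pose proof (Cmod_triangle (a O) (b O)).
  pose proof (Rmult_le_compat_l r _ _ Hr (IH (ftail a) (ftail b))).
  change (ftail (a + b)%fps) with (ftail a + ftail b)%fps.
  unfold fadd at 1. lra.
Qed.

Lemma absn_scal n z a r : absn n (fconst z * a)%fps r = (Cmod z * absn n a r)%R.
Proof.
  revert a; induction n as [|n IH]; intros a; cbn [absn].
  - rewrite fmul_const. apply Cmod_mult.
  - replace (ftail (fconst z * a)%fps) with (fconst z * ftail a)%fps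
      by (extensionality k; unfold ftail at 2; now rewrite !fmul_const).
    rewrite IH, fmul_const, Cmod_mult. ring.
Qed.

Lemma ftail_mul a b : ftail (a * b)%fps = (fconst (a O) * ftail b + ftail a * b)%fps.
Proof. extensionality n. unfold fadd. rewrite fmul_const. reflexivity. Qed.

Lemma absn_incr n a r : (0 <= r)%R -> (absn n a r <= absn (S n) a r)%R.
Proof.
  intros Hr. rewrite absn_S.
  pose proof (Rmult_le_pos _ _ (pow_le r (S n) Hr) (Cmod_ge_0 (a (S n)))). lra.
Qed.

Lemma absn_mul n a b r : (0 <= r)%R -> (absn n (a * b)%fps r <= absn n a r * absn n b r)%R.
Proof.
  intros Hr; revert a; induction n as [|n IH]; intros a.
  - simpl. rewrite Cmod_mult. lra.
  - change (absn (S n) (a * b)%fps r)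
      with (Cmod (a O * b O) + r * absn n (ftail (a * b)%fps) r)%R.
    rewrite ftail_mul, Cmod_mult.
    pose proof (absn_add n (fconst (a O) * ftail b) (ftail a * b) r Hr) as H1.
    rewrite absn_scal in H1. specialize (IH (ftail a)).
    apply (Rmult_le_compat_l r) in H1; [|exact Hr].
    apply (Rmult_le_compat_l r) in IH; [|exact Hr].
    pose proof (Rmult_le_compat_l (r * absn n (ftail a) r) _ _
      (Rmult_le_pos _ _ Hr (absn_pos n (ftail a) r Hr)) (absn_incr n b r Hr)) as H2.
    simpl absn in H2 |- *. nra.
Qed.

Lemma bnd_mul r a b A B : (0 <= r)%R -> bnd r a A -> bnd r b B -> bnd r (a * b)%fps (A * B).
Proof.
  intros Hr HA HB n. eapply Rle_trans; [now apply absn_mul|].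
  apply Rmult_le_compat; try apply absn_pos; auto.
Qed.

Lemma bnd_add r a b A B : (0 <= r)%R -> bnd r a A -> bnd r b B -> bnd r (a + b)%fps (A + B).
Proof.
  intros Hr HA HB n. eapply Rle_trans; [now apply absn_add|].
  apply Rplus_le_compat; auto.
Qed.

Lemma bnd_scal r z a A : bnd r a A -> bnd r (fconst z * a)%fps (Cmod z * A).
Proof.
  intros H n. rewrite absn_scal. apply Rmult_le_compat_l; [apply Cmod_ge_0 | apply H].
Qed.

Lemma bnd_const r z : bnd r (fconst z) (Cmod z).
Proof.
  assert (H0 : forall n, absn n (fconst 0) r = 0%R).
  { intros n. replace (fconst 0) with (fconst 0 * fconst 0)%fps by ring.
    rewrite absn_scal, Cmod_0. ring. }
  intros [|n]; simpl; [lra|].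
  replace (ftail (fconst z)) with (fconst 0) by (extensionality k; destruct k; reflexivity).
  rewrite H0. lra.
Qed.

(** Without constant term, the norm is at most proportional to the radius. *)
Lemma bnd_shrink r (a : fps) M d :
  a O = 0 -> (0 < r)%R -> (0 < d)%R -> bnd r a M ->
  exists r', (0 < r' <= r)%R /\ bnd r' a d.
Proof.
  intros a0 Hr Hd H. pose proof (bnd_ge0 _ _ _ H) as HM.
  (* the second radius makes the bound [r' M / r] at most [d] *)
  exists (Rmin r (d * r / (M + 1))).
  assert (Hp : (0 < d * r / (M + 1))%R) by (apply Rdiv_lt_0_compat; [nra | lra]).
  assert (Hr' : (0 < Rmin r (d * r / (M + 1)) <= r)%R)
    by (split; [now apply Rmin_pos | apply Rmin_l]).
  split; [exact Hr'|]. pose proof (Rmin_r r (d * r / (M + 1))) as Hle.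
  revert Hr' Hle. generalize (Rmin r (d * r / (M + 1))); intros r' Hr' Hle.
  intros [|n]; simpl; rewrite a0, Cmod_0; [lra|].
  pose proof (bnd_ftail _ _ _ Hr H n) as Ht.
  pose proof (absn_mono n (ftail a) r' r ltac:(lra)) as Hm.
  apply Rle_trans with (r' * (M / r))%R.
  - rewrite Rplus_0_l. apply Rmult_le_compat_l; lra.
  - apply Rle_trans with (d * r / (M + 1) * (M / r))%R.
    + apply Rmult_le_compat_r; [|exact Hle].
      apply Rmult_le_pos; [exact HM | left; now apply Rinv_0_lt_compat].
    + replace (d * r / (M + 1) * (M / r))%R with (d * (M / (M + 1)))%R by (field; lra).
      rewrite <- (Rmult_1_r d) at 2. apply Rmult_le_compat_l; [lra|].
      apply Rmult_le_reg_r with (M + 1)%R; [lra|]. field_simplify; lra.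
Qed.

Lemma psumn_bound n a x r : (Cmod x <= r)%R -> (Cmod (psumn n a x) <= absn n a r)%R.
Proof.
  intros Hx; pose proof (Cmod_ge_0 x); revert a; induction n as [|n IH]; intros a; simpl; [lra|].
  eapply Rle_trans; [apply Cmod_triangle|]. rewrite Cmod_mult.
  apply Rplus_le_compat_l, Rmult_le_compat; try apply Cmod_ge_0; auto.
Qed.

Lemma psumn_diff n k a x r : (Cmod x <= r)%R ->
  (Cmod (psumn (n + k) a x - psumn n a x) <= absn (n + k) a r - absn n a r)%R.
Proof.
  intros Hx. pose proof (Cmod_ge_0 x) as Hx0. induction k as [|k IH].
  - rewrite Nat.add_0_r. replace (_ - _) with (RtoC 0) by ring. rewrite Cmod_0. lra.
  - rewrite Nat.add_succ_r, psumn_S, absn_S.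
    replace (psumn (n + k) a x + x ^ S (n + k) * a (S (n + k)) - psumn n a x)
      with ((psumn (n + k) a x - psumn n a x) + x ^ S (n + k) * a (S (n + k))) by ring.
    eapply Rle_trans; [apply Cmod_triangle|]. rewrite Cmod_mult, Cmod_pow.
    pose proof (pow_incr (Cmod x) r (S (n + k)) ltac:(lra)) as Hp.
    pose proof (Rmult_le_compat_r _ _ _ (Cmod_ge_0 (a (S (n + k)))) Hp). lra.
Qed.

Lemma bnd_cv r a M x : bnd r a M -> (Cmod x <= r)%R ->
  exists s, clim (fun n => psumn n a x) s.
Proof.
  intros H Hx. pose proof (Cmod_ge_0 x) as Hx0.
  assert (Hc : Cauchy_crit (fun n => absn n a r)).
  { apply CV_Cauchy, growing_cv.
    - intros n. apply absn_incr. lra.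
    - exists M. intros y (n & ->). apply H. }
  apply clim_Cauchy. intros eps He. destruct (Hc eps He) as (N & HN). exists N.
  assert (ord : forall n m, (N <= n)%nat -> (n <= m)%nat ->
    (Cmod (psumn m a x - psumn n a x) < eps)%R).
  { intros n m Hn Hm. replace m with (n + (m - n))%nat by lia.
    eapply Rle_lt_trans; [now apply (psumn_diff n (m - n) a x r)|].
    specialize (HN (n + (m - n))%nat n ltac:(lia) ltac:(lia)). unfold Rdist in HN.
    eapply Rle_lt_trans; [apply Rle_abs | exact HN]. }
  intros n m Hn Hm. destruct (Nat.le_ge_cases n m) as [Hle|Hle].
  - rewrite Cmod_sub_sym. now apply ord.
  - now apply ord.
Qed.

Lemma psum_eq a x s : clim (fun n => psumn n a x) s -> psum a x = s.
Proof.
  intros H. apply clim_unique with (fun n => psumn n a x); [|exact H].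
  apply is_pseries_clim. unfold psum. apply epsilon_spec.
  exists s. now apply is_pseries_clim.
Qed.

Lemma psum_clim r a M x :
  bnd r a M -> (Cmod x <= r)%R -> clim (fun n => psumn n a x) (psum a x).
Proof.
  intros H Hx. destruct (bnd_cv r a M x H Hx) as (s & Hs).
  now rewrite (psum_eq a x s Hs).
Qed.

Lemma psum_le r a M x : bnd r a M -> (Cmod x <= r)%R -> (Cmod (psum a x) <= M)%R.
Proof.
  intros H Hx. eapply clim_le; [now apply (psum_clim r a M)|].
  intros n. eapply Rle_trans; [now apply (psumn_bound n a x r) | apply H].
Qed.

Lemma psum_rec r a M x : (0 < r)%R -> bnd r a M -> (Cmod x <= r)%R ->
  psum a x = a O + x * psum (ftail a) x.
Proof.
  intros Hr H Hx. apply psum_eq, clim_of_S. simpl.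
  apply clim_add; [apply clim_const | apply clim_scal].
  apply (psum_clim r _ (M / r)); [now apply bnd_ftail | exact Hx].
Qed.

Lemma psumn_add n a b x : psumn n (a + b)%fps x = psumn n a x + psumn n b x.
Proof.
  revert a b; induction n as [|n IH]; intros a b; simpl; [reflexivity|].
  change (ftail (a + b)%fps) with (ftail a + ftail b)%fps. rewrite IH.
  unfold fadd. ring.
Qed.

Lemma psumn_scal n z a x : psumn n (fconst z * a)%fps x = z * psumn n a x.
Proof.
  revert a; induction n as [|n IH]; intros a; cbn [psumn]; [apply fmul_const|].
  replace (ftail (fconst z * a)%fps) with (fconst z * ftail a)%fps
    by (extensionality k; unfold ftail at 2; now rewrite !fmul_const).
  rewrite IH, fmul_const. ring.
Qed.

Lemma psum_add r a b A B x : bnd r a A -> bnd r b B -> (Cmod x <= r)%R ->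
  psum (a + b)%fps x = psum a x + psum b x.
Proof.
  intros HA HB Hx. apply psum_eq.
  replace (fun n => psumn n (a + b)%fps x) with (fun n => psumn n a x + psumn n b x)
    by (extensionality n; now rewrite psumn_add).
  apply clim_add; eapply psum_clim; eassumption.
Qed.

Lemma psum_scal r z a A x : bnd r a A -> (Cmod x <= r)%R ->
  psum (fconst z * a)%fps x = z * psum a x.
Proof.
  intros HA Hx. apply psum_eq.
  replace (fun n => psumn n (fconst z * a)%fps x) with (fun n => z * psumn n a x)
    by (extensionality n; now rewrite psumn_scal).
  apply clim_scal; eapply psum_clim; eassumption.
Qed.

Lemma psum_const z x : psum (fconst z) x = z.
Proof.
  apply psum_eq.
  replace (fun n => psumn n (fconst z) x) with (fun _ : nat => z); [apply clim_const|].
  extensionality n. destruct n as [|n]; [reflexivity|]. simpl.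
  replace (ftail (fconst z)) with (fconst 0 * fconst 0)%fps.
  - rewrite psumn_scal. ring.
  - extensionality k. rewrite fmul_const. unfold ftail, fconst. ring.
Qed.

Lemma geometric_eq0 (d q K : R) :
  (0 <= d)%R -> (0 <= q < 1)%R -> (forall N, d <= q ^ N * K)%R -> d = 0%R.
Proof.
  intros Hd Hq H. apply Rle_eps_eq0; [exact Hd|]. intros eps He.
  destruct (pow_lt_1_zero q ltac:(rewrite Rabs_pos_eq; lra) (eps / (Rabs K + 1))%R)
    as (N & HN); [pose proof (Rabs_pos K); apply Rdiv_lt_0_compat; lra|].
  specialize (HN N (le_n N)). rewrite Rabs_pos_eq in HN by (apply pow_le; lra).
  eapply Rle_lt_trans; [apply (H N)|].
  pose proof (Rabs_pos K). pose proof (Rle_abs K). pose proof (pow_le q N ltac:(lra)).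
  apply Rle_lt_trans with (q ^ N * (Rabs K + 1))%R; [apply Rmult_le_compat_l; lra|].
  apply Rlt_le_trans with (eps / (Rabs K + 1) * (Rabs K + 1))%R.
  - apply Rmult_lt_compat_r; lra.
  - right. field. lra.
Qed.

Lemma Cminus_eq0 z w : Cmod (z - w) = 0%R -> z = w.
Proof. intros H. apply Cmod_eq_0 in H. transitivity (z - w + w); [ring | rewrite H; ring]. Qed.

(** [N] steps of the common recursion bound the difference by [(|w|/r)^N M K]. *)
Lemma eval_contraction (F F' : fps -> C) (w : C) (r K : R) :
  (0 < r)%R -> (0 <= K)%R -> (Cmod w < r)%R ->
  (forall a M, bnd r a M -> F a - F' a = w * (F (ftail a) - F' (ftail a))) ->
  (forall a M, bnd r a M -> Cmod (F a - F' a) <= M * K)%R ->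
  forall a M, bnd r a M -> F a = F' a.
Proof.
  intros Hr HK Hw Hrec Hle a M Ha.
  pose proof (Cmod_ge_0 w) as Hw0.
  apply Cminus_eq0, (geometric_eq0 _ (Cmod w / r) (M * K)); [apply Cmod_ge_0 | |].
  - split; [apply Rmult_le_pos; [exact Hw0 | left; now apply Rinv_0_lt_compat]|].
    apply Rmult_lt_reg_r with r; [exact Hr|]. field_simplify; lra.
  - intros N; revert a M Ha; induction N as [|N IH]; intros a M Ha.
    + simpl. rewrite Rmult_1_l. now apply Hle.
    + rewrite (Hrec a M Ha), Cmod_mult.
      eapply Rle_trans;
        [apply Rmult_le_compat_l; [exact Hw0 | apply (IH (ftail a) (M / r)%R); now apply bnd_ftail]|].
      right. simpl. field. lra.
Qed.

Ltac solve_bnd :=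
  repeat first [assumption | apply bnd_add | apply bnd_mul | apply bnd_const | lra].

(** From [a * b = a 0 * b + x * (ftail a * b)], the defect of multiplicativity reproduces
    itself with a factor [x]. *)
Lemma psum_mul r a b A B x : (0 < r)%R -> bnd r a A -> bnd r b B -> (Cmod x < r)%R ->
  psum (a * b)%fps x = psum a x * psum b x.
Proof.
  intros Hr HA HB Hx. pose proof (bnd_ge0 _ _ _ HB) as HB0.
  revert a A HA.
  apply (eval_contraction (fun a => psum (a * b)%fps x) (fun a => psum a x * psum b x)
    x r (2 * B)%R); [exact Hr | lra | exact Hx | |].
  - intros a M Ha.
    pose proof (bnd_ftail r a M Hr Ha) as Hta.
    pose proof (bnd_ftail r b B Hr HB) as Htb.
    rewrite (psum_rec r (a * b)%fps (M * B)), (psum_rec r a M) by solve_bnd.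
    rewrite ftail_mul.
    rewrite (psum_add r _ _ (Cmod (a O) * (B / r)) (M / r * B)),
      (psum_scal r _ _ (B / r)%R) by solve_bnd.
    rewrite (psum_rec r b B x) by solve_bnd. simpl. ring.
  - intros a M Ha.
    pose proof (psum_le r _ _ x (bnd_mul r a b M B ltac:(lra) Ha HB) ltac:(lra)) as H1.
    pose proof (psum_le r _ _ x Ha ltac:(lra)) as H2.
    pose proof (psum_le r _ _ x HB ltac:(lra)) as H3.
    replace (psum (a * b)%fps x - psum a x * psum b x)
      with (psum (a * b)%fps x + (- psum a x) * psum b x) by ring.
    eapply Rle_trans; [apply Cmod_triangle|]. rewrite Cmod_mult, Cmod_opp.
    pose proof (Rmult_le_compat _ _ _ _ (Cmod_ge_0 _) (Cmod_ge_0 _) H2 H3). lra.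
Qed.

Lemma absn_comp rho r (y : fps) : (0 <= r)%R -> y O = 0 -> bnd r y rho ->
  forall n g, (absn n (comp g y) r <= absn n g rho)%R.
Proof.
  intros Hr y0 Hy. pose proof (bnd_ge0 _ _ _ Hy) as Hrho.
  induction n as [|n IH]; intros g.
  - simpl. unfold comp; simpl. lra.
  - assert (E : ftail (comp g y) = (ftail y * comp (ftail g) y)%fps).
    { rewrite (comp_rec g) at 1 by exact y0. extensionality k.
      change (0 + (y * comp (ftail g) y)%fps (S k) = (ftail y * comp (ftail g) y)%fps k).
      simpl. rewrite y0. ring. }
    cbn [absn]. rewrite E. change (comp g y O) with (g O).
    apply Rplus_le_compat_l.
    pose proof (absn_mul n (ftail y) (comp (ftail g) y) r Hr) as H1.
    pose proof (Hy (S n)) as H2. cbn [absn] in H2. rewrite y0, Cmod_0, Rplus_0_l in H2.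
    apply Rle_trans with ((r * absn n (ftail y) r) * absn n (comp (ftail g) y) r)%R.
    + rewrite Rmult_assoc. now apply Rmult_le_compat_l.
    + apply Rmult_le_compat; [apply Rmult_le_pos; [exact Hr | now apply absn_pos] |
        now apply absn_pos | exact H2 | apply IH].
Qed.

Lemma bnd_comp rho r (y g : fps) G : (0 <= r)%R -> y O = 0 -> bnd r y rho -> bnd rho g G ->
  bnd r (comp g y) G.
Proof.
  intros Hr y0 Hy Hg n. eapply Rle_trans; [now apply (absn_comp rho) | apply Hg].
Qed.

(** From [comp_rec], the defect reproduces itself with the factor [psum y x], which is
    smaller than [rho] because [y] has no constant term. *)
Lemma psum_comp rho r (y g : fps) G x :
  (0 < r)%R -> (0 < rho)%R -> y O = 0 -> bnd r y rho -> bnd rho g G -> (Cmod x < r)%R ->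
  psum (comp g y) x = psum g (psum y x).
Proof.
  intros Hr Hrho y0 Hy Hg Hx.
  assert (Hw : (Cmod (psum y x) < rho)%R).
  { rewrite (psum_rec r y rho x Hr Hy) by lra. rewrite y0, Cplus_0_l, Cmod_mult.
    pose proof (psum_le r _ _ x (bnd_ftail r y rho Hr Hy) ltac:(lra)) as H.
    apply Rle_lt_trans with (Cmod x * (rho / r))%R.
    - apply Rmult_le_compat_l; [apply Cmod_ge_0 | exact H].
    - apply Rlt_le_trans with (r * (rho / r))%R; [|right; field; lra].
      apply Rmult_lt_compat_r; [now apply Rdiv_lt_0_compat | exact Hx]. }
  revert g G Hg.
  apply (eval_contraction (fun g => psum (comp g y) x) (fun g => psum g (psum y x))
    (psum y x) rho 2); [exact Hrho | lra | exact Hw | |].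
  - intros g G Hg.
    pose proof (bnd_ftail rho g G Hrho Hg) as Htg.
    pose proof (bnd_comp rho r y (ftail g) _ ltac:(lra) y0 Hy Htg) as Hc.
    rewrite (psum_rec rho g G) by (auto; lra).
    rewrite (comp_rec g) by exact y0.
    rewrite (psum_add r _ _ (Cmod (g O)) (rho * (G / rho)))
      by solve_bnd.
    rewrite psum_const, (psum_mul r _ _ rho (G / rho)) by auto. ring.
  - intros g G Hg.
    pose proof (psum_le r _ _ x (bnd_comp rho r y g G ltac:(lra) y0 Hy Hg) ltac:(lra)) as H1.
    pose proof (psum_le rho _ _ (psum y x) Hg ltac:(lra)) as H2.
    unfold Cminus. eapply Rle_trans; [apply Cmod_triangle|]. rewrite Cmod_opp. lra.
Qed.

(** * Germs and their Taylor series *)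

Definition convergent (a : fps) : Prop := exists r M, (0 < r)%R /\ bnd r a M.

Definition repr (f : C -> C) (a : fps) : Prop :=
  convergent a /\ near0 (fun x => f x = psum a x).

Lemma cv_terms_bounded a (x : C) s : clim (fun n => psumn n a x) s ->
  exists K, forall n, (Cmod x ^ n * Cmod (a n) <= K)%R.
Proof.
  intros H. destruct (H 1%R ltac:(lra)) as (N & HN).
  assert (Hfin : exists K, (0 <= K)%R /\ forall n, (n <= N)%nat -> (Cmod x ^ n * Cmod (a n) <= K)%R).
  { clear HN. induction N as [|N (K & HK0 & HK)].
    - exists (Cmod (a O)). split; [apply Cmod_ge_0|]. intros n Hn.
      replace n with O by lia. simpl. lra.
    - exists (Rmax K (Cmod x ^ S N * Cmod (a (S N)))). split.
      + eapply Rle_trans; [exact HK0 | apply Rmax_l].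
      + intros n Hn. destruct (Nat.eq_dec n (S N)) as [->|Hne]; [apply Rmax_r|].
        eapply Rle_trans; [apply HK; lia | apply Rmax_l]. }
  destruct Hfin as (K & HK0 & HK). exists (Rmax K 2). intros n.
  destruct (Nat.le_gt_cases n N) as [Hn|Hn].
  - eapply Rle_trans; [now apply HK | apply Rmax_l].
  - eapply Rle_trans; [|apply Rmax_r]. destruct n as [|n]; [lia|].
    rewrite <- Cmod_pow, <- Cmod_mult.
    replace (x ^ S n * a (S n)) with ((psumn (S n) a x - s) + (s - psumn n a x))
      by (rewrite psumn_S; ring).
    eapply Rle_trans; [apply Cmod_triangle|].
    pose proof (HN (S n) ltac:(lia)). pose proof (HN n ltac:(lia)).
    rewrite (Cmod_sub_sym s). lra.
Qed.

(** Abel's lemma, with the radius halved so that the bound is a geometric sum. *)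
Lemma bnd_of_terms a r K : (0 < r)%R -> (forall n, (r ^ n * Cmod (a n) <= K)%R) ->
  bnd (r / 2) a (2 * K).
Proof.
  intros Hr H.
  assert (E : forall n, (absn n a (r / 2) <= 2 * K - K * (/ 2) ^ n)%R).
  { induction n as [|n IH].
    - specialize (H O). simpl in *. lra.
    - rewrite absn_S. specialize (H (S n)).
      assert (E : ((r / 2) ^ S n = r ^ S n * (/ 2) ^ S n)%R)
        by (unfold Rdiv; apply Rpow_mult_distr).
      rewrite E. pose proof (pow_le (/ 2) (S n) ltac:(lra)) as Hp.
      pose proof (Rmult_le_compat_r _ _ _ Hp H) as H2.
      simpl pow in *. lra. }
  intros n. eapply Rle_trans; [apply E|].
  specialize (H O). simpl in H. pose proof (Cmod_ge_0 (a O)).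
  pose proof (Rmult_le_pos K ((/ 2) ^ n) ltac:(lra) ltac:(apply pow_le; lra)). lra.
Qed.

Lemma repr_of_pseries f a : locally (RtoC 0) (fun x => is_pseries a x (f x)) -> repr f a.
Proof.
  intros H. apply locally_near0 in H. split.
  - destruct H as (d & Hd & H).
    assert (Hx : Cmod (RtoC (d / 2)) = (d / 2)%R) by (rewrite Cmod_R, Rabs_pos_eq; lra).
    specialize (H (RtoC (d / 2)) ltac:(lra)). apply is_pseries_clim, cv_terms_bounded in H.
    destruct H as (K & HK). rewrite Hx in HK.
    exists (d / 2 / 2)%R, (2 * K)%R. split; [lra|]. apply bnd_of_terms; [lra | exact HK].
  - revert H. apply near0_imp. intros x Hx. symmetry. now apply psum_eq, is_pseries_clim.
Qed.

Lemma pseries_of_repr f a : repr f a -> locally (RtoC 0) (fun x => is_pseries a x (f x)).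
Proof.
  intros ((r & M & Hr & Ha) & H). apply locally_near0.
  destruct (near0_and _ (fun x => Cmod x <= r)%R H) as (d & Hd & H').
  - exists r. split; [exact Hr|]. intros x Hx. lra.
  - exists d. split; [exact Hd|]. intros x Hx. destruct (H' x Hx) as (E & Hxr).
    apply is_pseries_clim. rewrite E. now apply (psum_clim r a M).
Qed.

Lemma analytic0_repr f : analytic0 f <-> exists a, repr f a.
Proof.
  split; intros (a & H); exists a; [now apply repr_of_pseries | now apply pseries_of_repr].
Qed.

(** [a 0 = - x * psum (ftail a) x] tends to [0] with [x]. *)
Lemma psum_zero_head r M (a : fps) :
  (0 < r)%R -> bnd r a M ->
  (forall x : C, x <> 0 -> (Cmod x < r)%R -> psum a x = 0) -> a O = 0.
Proof.
  intros Hr Ha H.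
  apply Cmod_eq_0, Rle_eps_eq0; [apply Cmod_ge_0|]. intros eps He.
  pose proof (bnd_ftail r a M Hr Ha) as Ht.
  assert (HM : (0 <= M / r)%R) by (eapply bnd_ge0; exact Ht).
  set (t := Rmin (r / 2) (eps / (2 * (M / r + 1)))).
  assert (Ht0 : (0 < t)%R).
  { apply Rmin_pos; [lra|]. apply Rdiv_lt_0_compat; lra. }
  assert (Htr : (t <= r / 2)%R) by apply Rmin_l.
  assert (Hte : (t <= eps / (2 * (M / r + 1)))%R) by apply Rmin_r.
  assert (Hmt : Cmod (RtoC t) = t) by (rewrite Cmod_R, Rabs_pos_eq; lra).
  assert (Htn : RtoC t <> 0) by (intros E; apply RtoC_inj in E; lra).
  specialize (H (RtoC t) Htn ltac:(lra)).
  rewrite (psum_rec r a M) in H by (auto; lra).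
  replace (a O) with (- (t * psum (ftail a) t))
    by (transitivity (a O + t * psum (ftail a) t - t * psum (ftail a) t);
        [rewrite H; ring | ring]).
  rewrite Cmod_opp, Cmod_mult, Hmt.
  pose proof (psum_le r _ _ (RtoC t) Ht ltac:(lra)) as Hp.
  apply Rle_lt_trans with (t * (M / r))%R; [apply Rmult_le_compat_l; lra|].
  apply Rle_lt_trans with (eps / (2 * (M / r + 1)) * (M / r + 1))%R.
  - apply Rmult_le_compat; lra.
  - replace (eps / (2 * (M / r + 1)) * (M / r + 1))%R with (eps / 2)%R; [lra|].
    clear - HM. revert HM. generalize (M / r)%R. intros K HK. field. lra.
Qed.

(** The point [0] is excluded from the hypothesis so that it passes to [ftail a] after
    division by [x]. *)
Lemma psum_zero_unique r M (a : fps) :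
  (0 < r)%R -> bnd r a M ->
  (forall x : C, x <> 0 -> (Cmod x < r)%R -> psum a x = 0) -> forall n, a n = 0.
Proof.
  intros Hr Ha H n. revert M a Ha H; induction n as [|n IH]; intros M a Ha H.
  - now apply (psum_zero_head r M).
  - apply (IH (M / r)%R (ftail a)); [now apply bnd_ftail|].
    intros x Hx Hxr. pose proof (H x Hx Hxr) as E.
    rewrite (psum_rec r a M), (psum_zero_head r M a) in E by (auto; lra).
    transitivity (/ x * (0 + x * psum (ftail a) x)); [field; exact Hx | rewrite E; ring].
Qed.

Lemma convergent_common a b : convergent a -> convergent b ->
  exists r A B, (0 < r)%R /\ bnd r a A /\ bnd r b B.
Proof.
  intros (r & A & Hr & Ha) (r' & B & Hr' & Hb). exists (Rmin r r'), A, B.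
  assert (0 < Rmin r r')%R by now apply Rmin_pos.
  pose proof (Rmin_l r r'). pose proof (Rmin_r r r').
  split; [assumption|]. split; [apply (bnd_mono _ r) | apply (bnd_mono _ r')]; auto; lra.
Qed.

Lemma repr_unique f a b : repr f a -> repr f b -> a = b.
Proof.
  intros (Ha & Ea) (Hb & Eb).
  destruct (convergent_common a b Ha Hb) as (r & A & B & Hr & HA & HB).
  destruct (near0_and _ _ Ea Eb) as (d & Hd & E).
  apply fsub_eq0. replace (a - b)%fps with (a + fconst (-(1)) * b)%fps
    by (rewrite fconst_opp; ring).
  extensionality n. transitivity (RtoC 0); [|destruct n; reflexivity]. revert n.
  set (r' := Rmin r d). assert (Hr' : (0 < r')%R) by now apply Rmin_pos.
  assert (H1 : (r' <= r)%R) by apply Rmin_l. assert (H2 : (r' <= d)%R) by apply Rmin_r.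
  assert (HA' : bnd r' a A) by (apply (bnd_mono _ r); auto; lra).
  assert (HB' : bnd r' b B) by (apply (bnd_mono _ r); auto; lra).
  pose proof (bnd_scal r' (-(1)) b B HB') as HB2.
  apply (psum_zero_unique r' (A + Cmod (-(1)) * B)); [exact Hr' | |].
  - apply bnd_add; auto; lra.
  - intros x _ Hx. rewrite (psum_add r' _ _ A (Cmod (-(1)) * B)), (psum_scal r' _ _ B)
      by (auto; lra).
    destruct (E x ltac:(lra)) as (<- & <-). ring.
Qed.

Lemma near0_lt r : (0 < r)%R -> near0 (fun x => Cmod x < r)%R.
Proof. intros H. exists r. auto. Qed.

Lemma near0_all (P : C -> Prop) : (forall x, P x) -> near0 P.
Proof. intros H. exists 1%R. split; [lra | auto]. Qed.

Lemma repr_ext (f g : C -> C) a : near0 (fun x => f x = g x) -> repr f a -> repr g a.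
Proof.
  intros E (Ha & H). split; [exact Ha|]. generalize (near0_and _ _ E H).
  apply near0_imp. intros x (E1 & E2). now rewrite <- E1.
Qed.

Lemma repr_germ (f g : C -> C) a : repr f a -> repr g a -> near0 (fun x => f x = g x).
Proof.
  intros (_ & Hf) (_ & Hg). generalize (near0_and _ _ Hf Hg).
  apply near0_imp. intros x (-> & ->). reflexivity.
Qed.

Lemma repr_at0 f a : repr f a -> f 0 = a O.
Proof.
  intros ((r & M & Hr & Ha) & H). rewrite (near0_at _ H).
  rewrite (psum_rec r a M) by (auto; rewrite Cmod_0; lra). ring.
Qed.

Lemma repr_const z : repr (fun _ => z) (fconst z).
Proof.
  split.
  - exists 1%R, (Cmod z). split; [lra | apply bnd_const].
  - apply near0_all. intros x. now rewrite psum_const.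
Qed.

Lemma repr_id : repr (fun x => x) fX.
Proof.
  assert (E : ftail fX = fconst 1) by (extensionality n; destruct n; reflexivity).
  assert (HB : bnd 1 fX 1).
  { intros [|n]; simpl; rewrite ?E, Cmod_0; [lra|].
    pose proof (bnd_const 1 1 n) as H. rewrite Cmod_1 in H. lra. }
  split; [exists 1%R, 1%R; split; [lra | exact HB]|].
  exists 1%R. split; [lra|]. intros x Hx.
  rewrite (psum_rec 1 fX 1), E, psum_const by (auto; lra). simpl. ring.
Qed.

Lemma repr_add f g a b : repr f a -> repr g b -> repr (fun x => f x + g x) (a + b)%fps.
Proof.
  intros (Ha & Hf) (Hb & Hg).
  destruct (convergent_common a b Ha Hb) as (r & A & B & Hr & HA & HB). split.
  - exists r, (A + B)%R. split; [exact Hr | apply bnd_add; auto; lra].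
  - generalize (near0_and _ _ (near0_lt r Hr) (near0_and _ _ Hf Hg)). apply near0_imp.
    intros x (Hx & -> & ->). symmetry. apply (psum_add r a b A B); auto; lra.
Qed.

Lemma repr_mul f g a b : repr f a -> repr g b -> repr (fun x => f x * g x) (a * b)%fps.
Proof.
  intros (Ha & Hf) (Hb & Hg).
  destruct (convergent_common a b Ha Hb) as (r & A & B & Hr & HA & HB). split.
  - exists r, (A * B)%R. split; [exact Hr | apply bnd_mul; auto; lra].
  - generalize (near0_and _ _ (near0_lt r Hr) (near0_and _ _ Hf Hg)). apply near0_imp.
    intros x (Hx & -> & ->). symmetry. now apply (psum_mul r a b A B).
Qed.

Lemma repr_scal z f a : repr f a -> repr (fun x => z * f x) (fconst z * a)%fps.
Proof. intros H. exact (repr_mul _ _ _ _ (repr_const z) H). Qed.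

Lemma repr_sub f g a b : repr f a -> repr g b -> repr (fun x => f x - g x) (a - b)%fps.
Proof.
  intros Hf Hg. replace (a - b)%fps with (a + fconst (-(1)) * b)%fps
    by (rewrite fconst_opp; ring).
  apply (repr_ext (fun x => f x + -(1) * g x)).
  - apply near0_all. intros x; ring.
  - apply repr_add, repr_scal; assumption.
Qed.

Lemma repr_comp (f g : C -> C) a b : repr f a -> repr g b -> f 0 = 0 ->
  repr (fun x => g (f x)) (comp b a).
Proof.
  intros Hf Hg f0. assert (a0 : a O = 0) by (rewrite <- (repr_at0 f a Hf); exact f0).
  destruct Hf as ((r & A & Hr & HA) & Ef).
  destruct Hg as ((rho & B & Hrho & HB) & (d & Hd & Eg)).
  assert (Hm : (0 < Rmin rho (d / 2))%R) by (apply Rmin_pos; lra).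
  destruct (bnd_shrink r a A (Rmin rho (d / 2)) a0 Hr Hm HA) as (r' & Hr' & HA').
  pose proof (Rmin_l rho (d / 2)) as Hm1. pose proof (Rmin_r rho (d / 2)) as Hm2.
  assert (HB' : bnd (Rmin rho (d / 2)) b B) by (apply (bnd_mono _ rho); auto; lra).
  split.
  - exists r', B. split; [lra|]. apply (bnd_comp (Rmin rho (d / 2))); auto; lra.
  - generalize (near0_and _ _ (near0_lt r' ltac:(lra)) Ef). apply near0_imp.
    intros x (Hx & E).
    pose proof (psum_le r' _ _ x HA' ltac:(lra)) as Hle.
    rewrite (psum_comp (Rmin rho (d / 2)) r' a b B x) by (auto; lra).
    rewrite <- E in *. apply Eg. lra.
Qed.

Lemma repr_small (f : C -> C) a d : repr f a -> f 0 = 0 -> (0 < d)%R -> near0 (fun x => Cmod (f x) < d)%R.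
Proof.
  intros Hf f0 Hd. assert (a0 : a O = 0) by (rewrite <- (repr_at0 f a Hf); exact f0).
  destruct Hf as ((r & A & Hr & HA) & Ef).
  destruct (bnd_shrink r a A (d / 2) a0 Hr ltac:(lra) HA) as (r' & Hr' & HA').
  generalize (near0_and _ _ (near0_lt r' ltac:(lra)) Ef). apply near0_imp.
  intros x (Hx & ->). pose proof (psum_le r' _ _ x HA' ltac:(lra)). lra.
Qed.

Lemma repr_near0_comp (f : C -> C) a P : repr f a -> f 0 = 0 -> near0 P -> near0 (fun x => P (f x)).
Proof.
  intros Hf f0 (d & Hd & H). generalize (repr_small f a d Hf f0 Hd).
  apply near0_imp. auto.
Qed.

(** * Exponential, logarithm and powers *)

Definition fexp : fps := fun n => / INR (fact n).

Lemma RtoC_sum (u : nat -> R) (a : fps) (x : C) n :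
  (forall k, Cpow x k * a k = RtoC (u k)) -> psumn n a x = RtoC (sum_f_R0 u n).
Proof.
  intros H; induction n as [|n IH].
  - simpl. rewrite <- H. simpl. ring.
  - rewrite psumn_S, IH, H, tech5, RtoC_plus. reflexivity.
Qed.

Lemma infinite_sum_clim (u : nat -> R) (l : R) :
  infinite_sum u l -> clim (fun n => RtoC (sum_f_R0 u n)) (RtoC l).
Proof.
  intros H eps He. destruct (H eps He) as (N & HN). exists N. intros n Hn.
  rewrite <- RtoC_minus, Cmod_R. apply HN. exact Hn.
Qed.

Lemma psumn_fexp_R (x : R) : clim (fun n => psumn n fexp (RtoC x)) (RtoC (exp x)).
Proof.
  assert (H : exp_in x (exp x)) by (unfold exp; destruct (exist_exp x); assumption).
  apply infinite_sum_clim in H. revert H.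
  replace (fun n => psumn n fexp (RtoC x)) with
    (fun n => RtoC (sum_f_R0 (fun i => (/ INR (fact i) * x ^ i)%R) n)); [easy|].
  extensionality n. symmetry. apply RtoC_sum. intros k. unfold fexp.
  rewrite RtoC_mult, RtoC_pow, RtoC_inv by apply INR_fact_neq_0. ring.
Qed.

Lemma bnd_fexp r : (0 < r)%R -> exists M, bnd r fexp M.
Proof.
  intros Hr. destruct (cv_terms_bounded _ _ _ (psumn_fexp_R (2 * r))) as (K & HK).
  rewrite Cmod_R, Rabs_pos_eq in HK by lra.
  exists (2 * K)%R. replace r with (2 * r / 2)%R by field.
  apply bnd_of_terms; [lra | exact HK].
Qed.

Lemma psum_fexp_R (x : R) : psum fexp (RtoC x) = RtoC (exp x).
Proof. apply psum_eq, psumn_fexp_R. Qed.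

Lemma psum_fexp_clim (z : C) : clim (fun n => psumn n fexp z) (psum fexp z).
Proof.
  destruct (bnd_fexp (Cmod z + 1)) as (M & HM).
  - pose proof (Cmod_ge_0 z). lra.
  - apply (psum_clim (Cmod z + 1) _ M); [exact HM | lra].
Qed.

(** The terms of degree [2 j] and [2 j + 1] at [i y] are the [j]-th terms of the series that
    define [cos y] and [sin y], so partial sums are compared along odd lengths. *)
Lemma psum_fexp_Im (y : R) : psum fexp (Ci * y) = (cos y, sin y).
Proof.
  apply clim_unique with (fun k => psumn (2 * k + 1) fexp (Ci * y)).
  - intros eps He. destruct (psum_fexp_clim (Ci * y) eps He) as (N & HN).
    exists N. intros n Hn. apply HN. lia.
  - assert (Hc : cos_in (Rsqr y) (cos y))
      by (unfold cos; destruct (exist_cos (Rsqr y)); assumption).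
    assert (Hs : exists l, sin_in (Rsqr y) l /\ sin y = (y * l)%R)
      by (unfold sin; destruct (exist_sin (Rsqr y)) as (l & Hl); now exists l).
    destruct Hs as (l & Hs & ->).
    apply infinite_sum_clim in Hc. apply infinite_sum_clim in Hs.
    pose proof (clim_add _ _ _ _ Hc (clim_scal (Ci * y) _ _ Hs)) as H.
    replace (cos y, (y * l)%R) with (cos y + Ci * y * l).
    2:{ unfold Ci, RtoC, Cplus, Cmult; simpl. f_equal; ring. }
    revert H. match goal with |- clim ?u _ -> clim ?v _ => replace v with u; [easy|] end.
    extensionality k. symmetry.
    assert (Cpow_2 : forall j, Cpow (Ci * y) (2 * j) = RtoC ((-1) ^ j * Rsqr y ^ j)).
    { intros j. rewrite Cpow_mult_r, RtoC_mult, !RtoC_pow, <- Cpow_mult_l. f_equal.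
      rewrite <- RtoC_mult. simpl. unfold Ci, RtoC, Cmult, Rsqr; simpl. f_equal; ring. }
    assert (term0 : forall j, Cpow (Ci * y) (2 * j) * fexp (2 * j)%nat
      = RtoC (cos_n j * Rsqr y ^ j)).
    { intros j. rewrite Cpow_2. unfold fexp, cos_n.
      rewrite <- RtoC_inv, <- RtoC_mult by apply INR_fact_neq_0. f_equal. unfold Rdiv. ring. }
    assert (term1 : forall j, Cpow (Ci * y) (2 * j + 1) * fexp (2 * j + 1)%nat
      = Ci * y * RtoC (sin_n j * Rsqr y ^ j)).
    { intros j. rewrite Cpow_add_r, Cpow_2, Cpow_1_r. unfold fexp, sin_n.
      rewrite <- RtoC_inv by apply INR_fact_neq_0. unfold Rdiv. rewrite !RtoC_mult. ring. }
    induction k as [|k IH].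
    + pose proof (term0 O) as E0. pose proof (term1 O) as E1.
      simpl (2 * 0 + 1)%nat in *. simpl (2 * 0)%nat in *.
      rewrite psumn_S, E1. simpl (psumn 0 _ _). simpl (Cpow _ 0) in E0.
      cbn [sum_f_R0]. cbv beta. rewrite <- E0. ring.
    + replace (2 * S k + 1)%nat with (S (S (2 * k + 1))) by lia.
      rewrite !psumn_S, IH.
      replace (S (S (2 * k + 1))) with (2 * S k + 1)%nat by lia.
      replace (S (2 * k + 1)) with (2 * S k)%nat by lia.
      rewrite term0, term1, !tech5, !RtoC_plus. ring.
Qed.

Lemma fD_eigen_unique z f : fD f = (fconst z * f)%fps ->
  forall n, f n = f O * (Cpow z n * fexp n).
Proof.
  intros H n; induction n as [|n IH].
  - unfold fexp. simpl. field.
  - apply (f_equal (fun h : fps => h n)) in H. rewrite fmul_const in H. unfold fD in H.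
    rewrite IH in H. pose proof (INR_S_neq0 n) as N1. pose proof (fact_neq0 n) as N2.
    transitivity (/ (INR n + 1) * ((INR n + 1) * f (S n))); [field; exact N1|].
    rewrite H. unfold fexp. rewrite fact_simpl, mult_INR, RtoC_mult, RtoC_INR_S.
    simpl. field. split; assumption.
Qed.

(** The series of [exp (z x)] in [x].  The addition theorem of the exponential is the
    formal identity [fexp_at_add] evaluated at [x = 1]. *)
Definition fexp_at (z : C) : fps := fun n => Cpow z n * fexp n.

Lemma fD_fexp_at z : fD (fexp_at z) = (fconst z * fexp_at z)%fps.
Proof.
  extensionality n. rewrite fmul_const. unfold fD, fexp_at, fexp.
  rewrite fact_simpl, mult_INR, RtoC_mult, RtoC_INR_S. simpl.
  field. split; [apply fact_neq0 | apply INR_S_neq0].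
Qed.

Lemma fexp_at_add z w : (fexp_at z * fexp_at w)%fps = fexp_at (z + w).
Proof.
  extensionality n.
  rewrite (fD_eigen_unique (z + w)).
  - unfold fexp_at at 3. simpl. unfold fexp_at, fexp; simpl. field. apply fact_neq0.
  - rewrite fD_mul, !fD_fexp_at, fconst_add. ring.
Qed.

Lemma psumn_fexp_at n z x : psumn n (fexp_at z) x = psumn n fexp (x * z).
Proof.
  induction n as [|n IH].
  - simpl. unfold fexp_at. simpl. ring.
  - rewrite !psumn_S, IH. unfold fexp_at at 1. rewrite Cpow_mult_l. ring.
Qed.

Lemma absn_fexp_at n z r : absn n (fexp_at z) r = absn n fexp (r * Cmod z).
Proof.
  induction n as [|n IH].
  - simpl. unfold fexp_at. simpl. now rewrite Cmult_1_l.
  - rewrite !absn_S, IH. unfold fexp_at at 1.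
    rewrite Cmod_mult, Cmod_pow, Rpow_mult_distr. ring.
Qed.

Lemma psum_fexp_add z w : psum fexp (z + w) = psum fexp z * psum fexp w.
Proof.
  assert (E : forall v, psum (fexp_at v) 1 = psum fexp v).
  { intros v. apply psum_eq.
    replace (fun n => psumn n (fexp_at v) 1) with (fun n => psumn n fexp v)
      by (extensionality n; rewrite psumn_fexp_at; f_equal; ring).
    apply psum_fexp_clim. }
  assert (B : forall v, exists M, bnd 2 (fexp_at v) M).
  { intros v. pose proof (Cmod_ge_0 v).
    destruct (bnd_fexp (2 * Cmod v + 1) ltac:(lra)) as (M & HM).
    exists M. intros n. rewrite absn_fexp_at.
    apply (bnd_mono _ (2 * Cmod v + 1)); [lra | exact HM]. }
  destruct (B z) as (A1 & H1), (B w) as (A2 & H2).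
  rewrite <- !E, <- fexp_at_add.
  apply (psum_mul 2 _ _ A1 A2); auto; [lra|]. rewrite Cmod_1. lra.
Qed.

Lemma psum_fexp z : Cexp z = psum fexp z.
Proof.
  replace (psum fexp z) with (psum fexp (RtoC (Re z) + Ci * Im z)).
  - rewrite psum_fexp_add, psum_fexp_R, psum_fexp_Im. reflexivity.
  - f_equal. destruct z as (x, y). unfold Ci, RtoC, Cplus, Cmult; simpl. f_equal; ring.
Qed.

Lemma repr_Cexp : repr Cexp fexp.
Proof.
  destruct (bnd_fexp 1 ltac:(lra)) as (M & HM). split.
  - exists 1%R, M. split; [lra | exact HM].
  - apply near0_all, psum_fexp.
Qed.

Lemma Cexp_add z w : Cexp (z + w) = Cexp z * Cexp w.
Proof. rewrite !psum_fexp. apply psum_fexp_add. Qed.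

Lemma Cexp_0 : Cexp 0 = 1.
Proof.
  unfold Cexp. simpl. rewrite exp_0, cos_0, sin_0.
  unfold RtoC, Cmult; simpl. f_equal; ring.
Qed.

(** Equal moduli give equal real parts; then [1 = cos (y - y') = 1 - 2 sin^2 ((y - y')/2)]. *)
Lemma Cexp_inj z w : Cexp z = Cexp w -> (Rabs (Im z - Im w) < 2 * PI)%R -> z = w.
Proof.
  intros E Him.
  destruct z as (x, y), w as (x', y'). unfold Cexp in E. simpl in *.
  unfold RtoC, Cmult in E; simpl in E. injection E as E1 E2.
  rewrite !Rmult_0_l, ?Rminus_0_r, ?Rplus_0_r in *.
  pose proof (exp_pos x) as P. pose proof (exp_pos x') as P'.
  pose proof (sin2_cos2 y) as S1. pose proof (sin2_cos2 y') as S2. unfold Rsqr in *.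
  assert (Ex : exp x = exp x').
  { assert ((exp x * exp x = exp x' * exp x')%R).
    { transitivity ((exp x * cos y) * (exp x * cos y) + (exp x * sin y) * (exp x * sin y))%R.
      - replace (exp x * exp x)%R with (exp x * exp x * (sin y * sin y + cos y * cos y))%R
          by (rewrite S1; ring). ring.
      - rewrite E1, E2.
        replace (exp x' * exp x')%R with (exp x' * exp x' * (sin y' * sin y' + cos y' * cos y'))%R
          by (rewrite S2; ring). ring. }
    nra. }
  apply exp_inv in Ex. subst x'.
  apply Rmult_eq_reg_l in E1; [|lra]. apply Rmult_eq_reg_l in E2; [|lra].
  f_equal. set (d := ((y - y') / 2)%R).
  assert (Hd : (sin d * sin d = 0)%R).
  { assert (Hc : (cos (2 * d) = 1)%R).
    { unfold d. replace (2 * ((y - y') / 2))%R with (y - y')%R by field.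
      rewrite cos_minus, E1, E2. lra. }
    rewrite cos_2a_sin in Hc. lra. }
  assert (Hs : sin d = 0%R) by nra.
  apply Rabs_def2 in Him. destruct Him as (Hi1 & Hi2).
  destruct (Rtotal_order d 0) as [Hlt|[Heq|Hgt]].
  - pose proof (sin_gt_0 (- d) ltac:(lra) ltac:(unfold d in *; lra)) as Hp.
    rewrite sin_neg in Hp. lra.
  - unfold d in Heq. lra.
  - pose proof (sin_gt_0 d ltac:(lra) ltac:(unfold d in *; lra)). lra.
Qed.

(** Half-angle formulas: [t = Im z/(|z| + Re z)] is the tangent of half the argument. *)
Lemma Cexp_Clog z : (0 < Re z)%R -> Cexp (Clog z) = z.
Proof.
  destruct z as (x, y). simpl. intros Hx.
  set (r := Cmod (x, y)).
  assert (Hr2 : (r * r = x * x + y * y)%R).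
  { unfold r, Cmod. simpl fst; simpl snd. rewrite sqrt_sqrt; [ring | nra]. }
  assert (Hr : (0 < r)%R).
  { apply Cmod_gt_0. intros E. unfold RtoC in E. injection E. lra. }
  unfold Cexp, Clog. simpl Re; simpl Im. fold r. rewrite exp_ln by exact Hr.
  set (t := (y / (r + x))%R).
  assert (H1 : (0 < 1 + t * t)%R) by nra.
  assert (Hsq : (sqrt (1 + Rsqr t) * sqrt (1 + Rsqr t) = 1 + t * t)%R)
    by (unfold Rsqr; apply sqrt_sqrt; lra).
  assert (Hs0 : sqrt (1 + Rsqr t) <> 0%R).
  { intros E. rewrite E in Hsq. lra. }
  assert (Ht : (1 + t * t = 2 * r / (r + x))%R).
  { unfold t.
    transitivity (((r + x) * (r + x) + y * y) / ((r + x) * (r + x)))%R; [field; lra|].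
    replace (y * y)%R with (r * r - x * x)%R by lra. field. lra. }
  rewrite cos_2a_cos, sin_2a, cos_atan, sin_atan.
  set (s := sqrt (1 + Rsqr t)) in *.
  replace (2 * (1 / s) * (1 / s) - 1)%R with (x / r)%R.
  2:{ replace (2 * (1 / s) * (1 / s))%R with (2 / (s * s))%R by (field; exact Hs0).
      rewrite Hsq, Ht. field. lra. }
  replace (2 * (t / s) * (1 / s))%R with (y / r)%R.
  2:{ replace (2 * (t / s) * (1 / s))%R with (2 * t / (s * s))%R by (field; exact Hs0).
      rewrite Hsq, Ht. unfold t. field. lra. }
  unfold RtoC, Cmult; simpl. f_equal; field; lra.
Qed.

Lemma Clog_Im z : (Rabs (Im (Clog z)) < PI)%R.
Proof.
  unfold Clog. cbn [Im snd].
  match goal with |- context [atan ?u] => generalize u end.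
  intros t. pose proof (atan_bound t). apply Rabs_def1; lra.
Qed.

(** The imaginary part of [Clog] lies in [(-PI, PI)], which singles out the branch. *)
Lemma Clog_unique z w : (0 < Re z)%R -> Cexp w = z -> (Rabs (Im w) < PI)%R -> Clog z = w.
Proof.
  intros Hz E Hw. apply Cexp_inj.
  - now rewrite Cexp_Clog, E.
  - pose proof (Clog_Im z) as H. apply Rabs_def2 in H. apply Rabs_def2 in Hw.
    apply Rabs_def1; lra.
Qed.

(** The series of [log (1 - x)]. *)
Definition flog : fps := fun n => match n with O => RtoC 0 | S k => - / (INR k + 1) end.

Lemma fD_flog : fD flog = (- tpow (-(1)))%fps.
Proof.
  extensionality n. unfold fopp. unfold fD. simpl flog.
  assert (E : tpow (-(1)) n = 1).
  { assert (P : poch 1 n = INR (fact n)).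
    { induction n as [|n IH]; [reflexivity|]. cbn [poch].
      rewrite IH, fact_simpl, mult_INR, RtoC_mult, RtoC_INR_S. ring. }
    unfold tpow. replace (- - (1)) with (RtoC 1) by ring. rewrite P. field. apply fact_neq0. }
  rewrite E. field. apply INR_S_neq0.
Qed.

Lemma repr_flog : repr (psum flog) flog.
Proof.
  split; [|now apply near0_all].
  exists (1 / 2)%R, (2 * 1)%R. split; [lra|]. apply bnd_of_terms; [lra|].
  intros [|k]; rewrite pow1, Rmult_1_l; simpl flog.
  - rewrite Cmod_0. lra.
  - rewrite Cmod_opp, <- RtoC_INR_S, <- RtoC_inv, Cmod_R by now apply not_0_INR.
    pose proof (pos_INR k). rewrite S_INR.
    rewrite Rabs_pos_eq by (left; apply Rinv_0_lt_compat; lra).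
    rewrite <- Rinv_1. apply Rinv_le_contravar; lra.
Qed.

(** [exp (al log (1 - x))] solves the differential equation that characterises [tpow al]. *)
Lemma comp_fexp_flog al : comp fexp (fconst al * flog)%fps = tpow al.
Proof.
  assert (y0 : (fconst al * flog)%fps O = 0) by (rewrite fmul_const; simpl; ring).
  assert (De : fD fexp = fexp).
  { extensionality n. unfold fD, fexp.
    rewrite fact_simpl, mult_INR, RtoC_mult, RtoC_INR_S.
    field. split; [apply fact_neq0 | apply INR_S_neq0]. }
  apply tpow_unique.
  - rewrite fD_comp, De, fD_scal, fD_flog by exact y0.
    set (F := comp fexp _).
    assert (E : (tpow (-(1)) = fX * tpow (-(1)) + fconst 1)%fps).
    { transitivity (fX * tpow (-(1)) + tpow 1 * tpow (-(1)))%fps.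
      - rewrite tpow_one. ring.
      - rewrite tpow_add. replace (1 + -(1)) with (RtoC 0) by ring. now rewrite tpow_zero. }
    rewrite E at 1. ring.
  - unfold comp, fexp. simpl. field.
Qed.

Lemma psum_flog_0 : psum flog 0 = 0.
Proof. rewrite (repr_at0 _ _ repr_flog). reflexivity. Qed.

Lemma repr_Cexp_flog al : repr (fun x => Cexp (al * psum flog x)) (tpow al).
Proof.
  rewrite <- comp_fexp_flog.
  apply (repr_comp (fun x => al * psum flog x) Cexp).
  - apply repr_scal, repr_flog.
  - apply repr_Cexp.
  - rewrite psum_flog_0. ring.
Qed.

Lemma Re_pos_near1 z : (Cmod z < 1)%R -> (0 < Re (1 - z))%R.
Proof.
  intros H. pose proof (re_le_Cmod z) as Hr. unfold Re in *. simpl.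
  pose proof (Rle_abs (fst z)). lra.
Qed.

Lemma near0_Im_small (f : C -> C) a : repr f a -> f 0 = 0 ->
  near0 (fun x => Rabs (Im (f x)) < PI)%R.
Proof.
  intros H H0. generalize (repr_small f a PI H H0 PI_RGT_0). apply near0_imp.
  intros x Hx. eapply Rle_lt_trans; [|exact Hx].
  eapply Rle_trans; [|apply Rmax_Cmod]. apply Rmax_r.
Qed.

(** Both sides are logarithms of [1 - x] with imaginary parts in [(-PI, PI)]. *)
Lemma Clog_psum : near0 (fun x => Clog (1 - x) = psum flog x).
Proof.
  assert (H1 : near0 (fun x => Cexp (1 * psum flog x) = 1 - x)).
  { apply (repr_germ _ _ (tpow 1)); [apply repr_Cexp_flog|].
    rewrite tpow_one. apply repr_sub; [apply repr_const | apply repr_id]. }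
  generalize (near0_and _ _ (near0_lt 1 ltac:(lra)) (near0_and _ _ H1
    (near0_Im_small _ _ repr_flog psum_flog_0))).
  apply near0_imp. intros x (Hx & E & Him).
  rewrite Cmult_1_l in E. apply Clog_unique; [now apply Re_pos_near1 | exact E | exact Him].
Qed.

Lemma repr_Cpower_1_sub al : repr (fun x => Cpower (1 - x) al) (tpow al).
Proof.
  apply (repr_ext (fun x => Cexp (al * psum flog x))); [|apply repr_Cexp_flog].
  generalize Clog_psum. apply near0_imp. intros x E. unfold Cpower. now rewrite E.
Qed.

Lemma Cpower_add z al be : Cpower z (al + be) = Cpower z al * Cpower z be.
Proof. unfold Cpower. rewrite <- Cexp_add. f_equal. ring. Qed.

Lemma Cpower_0 z : Cpower z 0 = 1.
Proof. unfold Cpower. rewrite Cmult_0_l. apply Cexp_0. Qed.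

Lemma Cpower_neq0 z al : Cpower z al <> 0.
Proof.
  intros E.
  assert (H : Cpower z al * Cpower z (- al) = 1).
  { rewrite <- Cpower_add. replace (al + - al) with (RtoC 0) by ring. apply Cpower_0. }
  rewrite E, Cmult_0_l in H. symmetry in H. now apply RtoC_inj, R1_neq_R0 in H.
Qed.

Lemma Cpower_INR z n : (0 < Re z)%R -> Cpower z (INR n) = Cpow z n.
Proof.
  intros Hz; induction n as [|n IH]; [apply Cpower_0|].
  rewrite RtoC_INR_S, Cpower_add, IH. simpl.
  unfold Cpower at 1. rewrite Cmult_1_l, Cexp_Clog by exact Hz. ring.
Qed.

Lemma Cpower_opp z al : Cpower z (- al) = / Cpower z al.
Proof.
  transitivity (/ Cpower z al * (Cpower z al * Cpower z (- al))).
  - field. apply Cpower_neq0.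
  - rewrite <- Cpower_add. replace (al + - al) with (RtoC 0) by ring.
    rewrite Cpower_0. ring.
Qed.

Lemma Cpow_Z_Cpower z m : (0 < Re z)%R -> Cpow_Z z m = Cpower z (IZR m).
Proof.
  intros Hz. destruct m as [|p|p]; simpl Cpow_Z.
  - symmetry. apply Cpower_0.
  - rewrite <- Cpower_INR by exact Hz. now rewrite INR_IPR.
  - rewrite <- Cpower_INR, <- Cpower_opp by exact Hz.
    f_equal. now rewrite INR_IPR, IZR_NEG, RtoC_opp.
Qed.

Lemma near0_Re_Cpower al : near0 (fun x => 0 < Re (Cpower (1 - x) al))%R.
Proof.
  assert (H1 : near0 (fun x => Cmod (1 - Cpower (1 - x) al) < 1)%R).
  { apply (repr_small _ (fconst 1 - tpow al)%fps 1).
    - apply repr_sub; [apply repr_const | apply repr_Cpower_1_sub].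
    - rewrite (repr_at0 _ _ (repr_Cpower_1_sub al)), tpow_0. ring.
    - lra. }
  revert H1. apply near0_imp. intros x Hx. apply Re_pos_near1 in Hx.
  replace (1 - (1 - Cpower (1 - x) al)) with (Cpower (1 - x) al) in Hx by ring.
  exact Hx.
Qed.

(** Near [x = 0] the number [al log (1 - x)] is small, so it is the principal logarithm of
    [(1 - x)^al]. *)
Lemma Cpower_Cpower al be :
  near0 (fun x => Cpower (Cpower (1 - x) al) be = Cpower (1 - x) (al * be)).
Proof.
  assert (Hs : repr (fun x => al * psum flog x) (fconst al * flog)%fps)
    by apply repr_scal, repr_flog.
  generalize (near0_and _ _ Clog_psum (near0_and _ _ (near0_Re_Cpower al)
    (near0_Im_small _ _ Hs ltac:(cbv beta; rewrite psum_flog_0; ring)))).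
  apply near0_imp. intros x (E & Hre & Him).
  unfold Cpower at 1.
  rewrite (Clog_unique _ (al * psum flog x)).
  - unfold Cpower. rewrite E. f_equal. ring.
  - exact Hre.
  - unfold Cpower. now rewrite E.
  - exact Him.
Qed.

Lemma repr_psum a : convergent a -> repr (psum a) a.
Proof. intros H. split; [exact H | now apply near0_all]. Qed.

Lemma bnd_term r a M n : (0 <= r)%R -> bnd r a M -> (r ^ n * Cmod (a n) <= M)%R.
Proof.
  intros Hr H. eapply Rle_trans; [|apply (H n)]. destruct n as [|n].
  - simpl. lra.
  - rewrite absn_S. pose proof (absn_pos n a r Hr). lra.
Qed.

(** * The change of variable *)

(** The local inverse of [Fm m]. *)
Definition phim (m : Z) (w : C) : C := 1 - Cpower (1 - w) (/ IZR m).

Lemma repr_Fm m : repr (Fm m) (fY (IZR m)).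
Proof.
  apply (repr_ext (fun x => 1 - Cpower (1 - x) (IZR m))).
  - generalize (near0_lt 1 ltac:(lra)). apply near0_imp. intros x Hx.
    unfold Fm. rewrite Cpow_Z_Cpower by now apply Re_pos_near1. reflexivity.
  - apply repr_sub; [apply repr_const | apply repr_Cpower_1_sub].
Qed.

Lemma repr_phim m : repr (phim m) (fPhi (IZR m)).
Proof. apply repr_sub; [apply repr_const | apply repr_Cpower_1_sub]. Qed.

Lemma Fm_0 m : Fm m 0 = 0.
Proof. rewrite (repr_at0 _ _ (repr_Fm m)). apply fY_0. Qed.

Lemma phim_0 m : phim m 0 = 0.
Proof. rewrite (repr_at0 _ _ (repr_phim m)). apply fPhi_0. Qed.

Lemma Cpower_1 z : (0 < Re z)%R -> Cpower z 1 = z.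
Proof. intros H. unfold Cpower. rewrite Cmult_1_l. now apply Cexp_Clog. Qed.

Lemma IZR_neq0 m : m <> 0%Z -> RtoC (IZR m) <> 0.
Proof. intros H E. apply RtoC_inj in E. now apply eq_IZR in E. Qed.

Lemma Cpower_one_sub_Fm m be :
  near0 (fun x => Cpower (1 - Fm m x) be = Cpower (1 - x) (IZR m * be)).
Proof.
  generalize (near0_and _ _ (near0_lt 1 ltac:(lra)) (Cpower_Cpower (IZR m) be)).
  apply near0_imp. intros x (Hx & <-). f_equal. unfold Fm.
  rewrite Cpow_Z_Cpower by now apply Re_pos_near1. ring.
Qed.

Lemma phim_Fm m : m <> 0%Z -> near0 (fun x => phim m (Fm m x) = x).
Proof.
  intros Hm. generalize (near0_and _ _ (near0_lt 1 ltac:(lra)) (Cpower_one_sub_Fm m (/ IZR m))).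
  apply near0_imp. intros x (Hx & E). unfold phim. rewrite E.
  rewrite Cinv_r, Cpower_1 by (try apply Re_pos_near1; try apply IZR_neq0; assumption). ring.
Qed.

Lemma Fm_phim m : m <> 0%Z -> near0 (fun w => Fm m (phim m w) = w).
Proof.
  intros Hm. generalize (near0_and _ _ (near0_lt 1 ltac:(lra))
    (near0_and _ _ (near0_Re_Cpower (/ IZR m)) (Cpower_Cpower (/ IZR m) (IZR m)))).
  apply near0_imp. intros w (Hw & Hre & E). unfold Fm, phim.
  replace (1 - (1 - Cpower (1 - w) (/ IZR m))) with (Cpower (1 - w) (/ IZR m)) by ring.
  rewrite Cpow_Z_Cpower, E by exact Hre.
  rewrite Cinv_l, Cpower_1 by (try apply Re_pos_near1; try apply IZR_neq0; assumption). ring.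
Qed.

Lemma comp_ext_upto (f g y : fps) n :
  (forall k, (k <= n)%nat -> f k = g k) -> comp f y n = comp g y n.
Proof.
  intros H. unfold comp.
  assert (E : forall N (f g : fps), (forall k, (k <= N)%nat -> f k = g k) ->
    comp_fuel N f y = comp_fuel N g y).
  { clear. induction N as [|N IH]; intros f g H; simpl; rewrite (H O) by lia; [reflexivity|].
    rewrite (IH (ftail f) (ftail g)); [reflexivity|]. intros k Hk. apply H. lia. }
  now rewrite (E n f g H).
Qed.

Lemma convergent_polynomial n (f : fps) : (forall k, (n < k)%nat -> f k = 0) -> convergent f.
Proof.
  revert f; induction n as [|n IH]; intros f H; rewrite (fps_decomp f).
  - replace (ftail f) with (fconst 0).
    + replace (fconst (f O) + fX * fconst 0)%fps with (fconst (f O)) by ring.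
      apply (repr_const (f O)).
    + extensionality k. unfold ftail. rewrite H by lia. destruct k; reflexivity.
  - assert (Ht : convergent (ftail f)) by (apply IH; intros k Hk; apply H; lia).
    exact (proj1 (repr_add _ _ _ _ (repr_const (f O))
      (repr_mul _ _ _ _ repr_id (repr_psum _ Ht)))).
Qed.

(** A coefficient of a composite involves only finitely many coefficients of [f], so [f] may
    be truncated to a polynomial, which is a germ; for germs the claim is the hypothesis. *)
Lemma comp_inverse (u v : C -> C) (U V : fps) :
  repr u U -> repr v V -> u 0 = 0 -> v 0 = 0 -> near0 (fun x => u (v x) = x) ->
  forall f, comp (comp f U) V = f.
Proof.
  intros Hu Hv u0 v0 Huv f. extensionality n.
  set (g := fun k => if (k <=? n)%nat then f k else RtoC 0).
  assert (E : forall k, (k <= n)%nat -> f k = g k).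
  { intros k Hk. unfold g. apply Nat.leb_le in Hk. now rewrite Hk. }
  rewrite (comp_ext_upto (comp f U) (comp g U)), (E n (le_n n)).
  2:{ intros k Hk. apply comp_ext_upto. intros j Hj. apply E. lia. }
  apply (f_equal (fun h : fps => h n)).
  assert (Hg : repr (psum g) g).
  { apply repr_psum, (convergent_polynomial n). intros k Hk. unfold g.
    destruct (Nat.leb_spec k n); [lia | reflexivity]. }
  apply (repr_unique (psum g)); [|exact Hg].
  apply (repr_ext (fun x => psum g (u (v x)))).
  - revert Huv. apply near0_imp. now intros x ->.
  - apply (repr_comp v (fun w => psum g (u w))); [exact Hv | | exact v0].
    now apply repr_comp.
Qed.

Lemma comp_fPhi_fY m f : m <> 0%Z -> comp (comp f (fPhi (IZR m))) (fY (IZR m)) = f.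
Proof.
  intros Hm. apply (comp_inverse (phim m) (Fm m));
    auto using repr_phim, repr_Fm, phim_0, Fm_0, phim_Fm.
Qed.

Lemma comp_fY_fPhi m f : m <> 0%Z -> comp (comp f (fY (IZR m))) (fPhi (IZR m)) = f.
Proof.
  intros Hm. apply (comp_inverse (Fm m) (phim m));
    auto using repr_phim, repr_Fm, phim_0, Fm_0, Fm_phim.
Qed.

(** * Operators on germs *)

(** [A] acts on Taylor series as [F].  In particular the Taylor series of [A f] depends
    only on the germ of [f]. *)
Definition op_repr (A : op) (F : fps -> fps) : Prop :=
  forall f a, repr f a -> repr (A f) (F a).

Lemma op_repr_comp A B F G : op_repr A F -> op_repr B G ->
  op_repr (A ** B)%op (fun a => F (G a)).
Proof. intros HA HB f a H. now apply HA, HB. Qed.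

Lemma op_repr_prod A F n :
  (forall j, (1 <= j <= n)%nat -> op_repr (A j) (F j)) ->
  op_repr (op_prod_nat A n) (fprod F n).
Proof.
  induction n as [|n IH]; intros H f a Hf; simpl; [exact Hf|].
  apply IH; [intros j Hj; apply H; lia|]. apply H; [lia | exact Hf].
Qed.

Lemma op_repr_pow h al P : repr (fun x => Cpower (h x) al) P ->
  op_repr (op_pow h al) (fun a => P * a)%fps.
Proof. intros H f a Hf. now apply repr_mul. Qed.

Lemma op_repr_one_sub_Fm m be :
  op_repr (op_pow (fun x => 1 - Fm m x) be) (fun a => tpow (IZR m * be) * a)%fps.
Proof.
  apply op_repr_pow. apply (repr_ext (fun x => Cpower (1 - x) (IZR m * be))).
  - generalize (Cpower_one_sub_Fm m be). apply near0_imp. intros x E. now symmetry.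
  - apply repr_Cpower_1_sub.
Qed.

(** Near [0], [mu x/y] is the reciprocal of the convergent series [fq mu], whose value at
    [0] is [1]; in terms of [v = 1 - fq mu], its power [al] is [(1 - v)^(- al)]. *)
Lemma op_repr_mx_over_y m al : m <> 0%Z ->
  op_repr (op_pow (mx_over_y m) al) (fun a => hpow (IZR m) al * a)%fps.
Proof.
  intros Hm. apply op_repr_pow. set (mu := RtoC (IZR m)).
  assert (Hmu : mu <> 0) by now apply IZR_neq0.
  assert (Hq : repr (psum (fq mu)) (fq mu)).
  { apply repr_psum. destruct (repr_Fm m) as ((r & M & Hr & HY) & _).
    exists r, (Cmod (/ mu) * (M / r))%R. split; [exact Hr|].
    now apply bnd_scal, bnd_ftail. }
  assert (q0 : psum (fq mu) 0 = 1).
  { pose proof (one_sub_fq_0 mu Hmu) as E. unfold fsub in E. simpl in E.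
    rewrite (repr_at0 _ _ Hq). transitivity (1 - (1 - fq mu O)); [ring | rewrite E; ring]. }
  set (v := fun x => 1 - psum (fq mu) x).
  assert (Hv : repr v (fconst 1 - fq mu)%fps) by (apply repr_sub; [apply repr_const | exact Hq]).
  assert (v0 : v 0 = 0) by (unfold v; rewrite q0; ring).
  assert (HF : near0 (fun x => Fm m x = mu * (x * psum (fq mu) x))).
  { apply (repr_germ _ _ (fY mu)); [apply repr_Fm|].
    rewrite (fY_eq mu Hmu). apply repr_scal, repr_mul; [apply repr_id | exact Hq]. }
  apply (repr_ext (fun x => Cpower (1 - v x) (- al))).
  2:{ apply (repr_comp v (fun u => Cpower (1 - u) (- al))); auto using repr_Cpower_1_sub. }
  generalize (near0_and _ _ HF (near0_and _ _ (repr_small v _ 1 Hv v0 ltac:(lra))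
    (repr_near0_comp v _ _ Hv v0 (Cpower_Cpower (-(1)) al)))).
  apply near0_imp. intros x (E & Hvx & Ep).
  replace (- al) with (-(1) * al) by ring. rewrite <- Ep. f_equal.
  apply Re_pos_near1 in Hvx.
  rewrite Cpower_opp, Cpower_1 by exact Hvx.
  unfold v in *. replace (1 - (1 - psum (fq mu) x)) with (psum (fq mu) x) in * by ring.
  unfold mx_over_y. fold mu. destruct (Ceq_dec x 0) as [->|Hx].
  - rewrite q0. field.
  - rewrite E. field. repeat split; try assumption.
    intros E0. rewrite E0 in Hvx. simpl in Hvx. lra.
Qed.

Lemma ratio_bounded (a c : C) : permissible c ->
  exists K, (1 <= K)%R /\ forall n, (Cmod (a + INR n) <= K * Cmod (c + INR n))%R.
Proof.
  intros Hc.
  assert (Hpos : forall n, (0 < Cmod (c + INR n))%R).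
  { intros n. apply Cmod_gt_0. intros E. apply (Hc n).
    transitivity (c + INR n - INR n); [ring | rewrite E; ring]. }
  assert (Hfin : forall N, exists K, (1 <= K)%R /\
    forall n, (n <= N)%nat -> (Cmod (a + INR n) <= K * Cmod (c + INR n))%R).
  { assert (one : forall n, exists K, (1 <= K)%R /\ (Cmod (a + INR n) <= K * Cmod (c + INR n))%R).
    { intros n. exists (1 + Cmod (a + INR n) / Cmod (c + INR n))%R.
      pose proof (Cmod_ge_0 (a + INR n)) as H0. pose proof (Hpos n) as H1.
      assert (0 <= Cmod (a + INR n) / Cmod (c + INR n))%R
        by (apply Rmult_le_pos; [exact H0 | left; now apply Rinv_0_lt_compat]).
      split; [lra|]. field_simplify; lra. }
    induction N as [|N (K & HK1 & HK)].
    - destruct (one O) as (K & HK1 & HK). exists K. split; [exact HK1|].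
      intros n Hn. now replace n with O by lia.
    - destruct (one (S N)) as (K' & HK1' & HK'). exists (Rmax K K').
      split; [eapply Rle_trans; [exact HK1 | apply Rmax_l]|].
      intros n Hn. destruct (Nat.eq_dec n (S N)) as [->|Hne].
      + eapply Rle_trans; [exact HK'|]. apply Rmult_le_compat_r; [left; apply Hpos | apply Rmax_r].
      + eapply Rle_trans; [apply HK; lia|].
        apply Rmult_le_compat_r; [left; apply Hpos | apply Rmax_l]. }
  destruct (INR_unbounded (2 * Cmod c + 1)) as (N & HN).
  destruct (Hfin N) as (K & HK1 & HK).
  (* for [n > N] the triangle inequality gives [|c + n| >= n/2] and [|c + n| >= 1/2] *)
  exists (K + 2 * (Cmod a + 1))%R. pose proof (Cmod_ge_0 a) as Ha. pose proof (Cmod_ge_0 c) as Hc0.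
  split; [lra|]. intros n. pose proof (Hpos n) as Hp.
  destruct (Nat.le_gt_cases n N) as [Hn|Hn].
  - specialize (HK n Hn). nra.
  - assert (HnN : (2 * Cmod c + 1 < INR n)%R) by (apply lt_INR in Hn; lra).
    pose proof (Cmod_triangle a (INR n)) as H1.
    pose proof (Cmod_triangle (c + INR n) (- c)) as H2.
    replace (c + INR n + - c) with (RtoC (INR n)) in H2 by ring.
    rewrite Cmod_opp in H2. rewrite Cmod_R, Rabs_pos_eq in H1, H2 by lra.
    nra.
Qed.

(** The ratios [(a + n)/(c + n)] are bounded, so [poch a n/poch c n] grows at most
    geometrically. *)
Lemma convergent_fhyp al c a : permissible c -> convergent a -> convergent (fhyp al c a).
Proof.
  intros Hc (r & M & Hr & Ha).
  destruct (ratio_bounded al c Hc) as (K & HK1 & HK).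
  exists (r / K / 2)%R, (2 * M)%R.
  assert (HrK : (0 < r / K)%R) by (apply Rdiv_lt_0_compat; lra).
  split; [lra|]. apply bnd_of_terms; [exact HrK|]. intros n.
  assert (E : (Cmod (poch al n / poch c n) <= K ^ n)%R).
  { rewrite Cmod_div by now apply poch_neq0.
    assert (Hp : (0 < Cmod (poch c n))%R) by now apply Cmod_gt_0, poch_neq0.
    assert (H : (Cmod (poch al n) <= K ^ n * Cmod (poch c n))%R).
    { clear Hp. induction n as [|n IH]; simpl; [lra|]. rewrite !Cmod_mult.
      replace (K * K ^ n * (Cmod (poch c n) * Cmod (c + INR n)))%R
        with ((K ^ n * Cmod (poch c n)) * (K * Cmod (c + INR n)))%R by ring.
      apply Rmult_le_compat; try apply Cmod_ge_0; auto. }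
    apply Rmult_le_reg_r with (Cmod (poch c n)); [exact Hp|].
    replace (Cmod (poch al n) / Cmod (poch c n) * Cmod (poch c n))%R
      with (Cmod (poch al n)) by (field; lra). exact H. }
  unfold fhyp. rewrite Cmod_mult.
  eapply Rle_trans; [|apply (bnd_term r a M n); [lra | exact Ha]].
  replace (r ^ n)%R with ((r / K) ^ n * K ^ n)%R
    by (rewrite <- Rpow_mult_distr; f_equal; field; lra).
  rewrite !Rmult_assoc. apply Rmult_le_compat_l; [apply pow_le; lra|].
  rewrite (Rmult_comm (K ^ n)). apply Rmult_le_compat_l; [apply Cmod_ge_0 | exact E].
Qed.

Lemma taylor_repr f a : repr f a -> taylor f = a.
Proof.
  intros H. apply (repr_unique f); [|exact H]. apply repr_of_pseries.
  unfold taylor. apply (epsilon_spec (inhabits (fun _ : nat => RtoC 0))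
    (fun b => locally (RtoC 0) (fun x => is_pseries b x (f x)))).
  exists a. now apply pseries_of_repr.
Qed.

Lemma op_repr_hyp al c : permissible c -> op_repr (hyp al c) (fhyp al c).
Proof.
  intros Hc f a Hf. unfold hyp. rewrite (taylor_repr f a Hf).
  apply repr_psum, convergent_fhyp; [exact Hc | apply Hf].
Qed.

(** Composing [f = g o y] with the local inverse of [y] determines the germ [g]. *)
Lemma factor_through_repr m f b : m <> 0%Z -> repr f b ->
  repr (factor_through (Fm m) f) (comp b (fPhi (IZR m))).
Proof.
  intros Hm Hf.
  assert (Hg : repr (fun w => f (phim m w)) (comp b (fPhi (IZR m))))
    by (apply repr_comp; auto using repr_phim, phim_0).
  assert (Hex : exists g, analytic0 g /\ germ_eq f (fun x => g (Fm m x))).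
  { exists (fun w => f (phim m w)). split; [apply analytic0_repr; now exists (comp b (fPhi (IZR m)))|].
    apply locally_near0. generalize (phim_Fm m Hm). apply near0_imp. now intros x ->. }
  apply (epsilon_spec (inhabits (fun _ : C => RtoC 0))) in Hex.
  fold (factor_through (Fm m) f) in Hex. destruct Hex as (_ & E).
  apply locally_near0 in E.
  apply (repr_ext (fun w => f (phim m w))); [|exact Hg].
  generalize (near0_and _ _ (Fm_phim m Hm) (repr_near0_comp (phim m) _ _ (repr_phim m) (phim_0 m) E)).
  apply near0_imp. intros w (E1 & ->). now rewrite E1.
Qed.

Lemma op_repr_hyp_wrt m al c : m <> 0%Z -> permissible c ->
  op_repr (hyp_wrt (Fm m) al c) (fhyp_wrt (IZR m) al c).
Proof.
  intros Hm Hc f b Hf. unfold hyp_wrt, fhyp_wrt.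
  apply (repr_comp (Fm m)); [apply repr_Fm | | apply Fm_0].
  apply op_repr_hyp; [exact Hc|]. now apply factor_through_repr.
Qed.

Lemma fhyp_wrt_inverse m al c f : m <> 0%Z -> permissible al -> permissible c ->
  fhyp_wrt (IZR m) al c (fhyp_wrt (IZR m) c al f) = f.
Proof.
  intros Hm Ha Hc. unfold fhyp_wrt. rewrite comp_fY_fPhi by exact Hm.
  replace (fhyp al c (fhyp c al (comp f (fPhi (IZR m))))) with (comp f (fPhi (IZR m))).
  - now apply comp_fPhi_fY.
  - extensionality n. unfold fhyp. field. split; now apply poch_neq0.
Qed.

(** The operator [B] witnesses that the germ chosen by [op_inv] exists; injectivity of [F]
    identifies its Taylor series. *)
Lemma op_repr_inv A B F G :
  op_repr A F -> op_repr B G -> (forall a, F (G a) = a) -> (forall a, G (F a) = a) ->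
  op_repr (op_inv A) G.
Proof.
  intros HA HB HFG HGF f b Hf.
  assert (Hex : exists g, analytic0 g /\ germ_eq (A g) f).
  { exists (B f). split; [apply analytic0_repr; exists (G b); now apply HB|].
    apply locally_near0, (repr_germ _ _ b); [|exact Hf].
    rewrite <- (HFG b). now apply HA, HB. }
  apply (epsilon_spec (inhabits (fun _ : C => RtoC 0))) in Hex.
  fold (op_inv A f) in Hex. destruct Hex as (Han & E).
  apply analytic0_repr in Han. destruct Han as (g & Hg).
  apply locally_near0 in E.
  assert (Eb : F g = b).
  { apply (repr_unique f); [|exact Hf].
    apply (repr_ext (A (op_inv A f))); [exact E | now apply HA]. }
  rewrite <- Eb, HGF. exact Hg.
Qed.

Lemma op_repr_iff A F G : (forall a, F a = G a) -> op_repr A F -> op_repr A G.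
Proof. intros E H f a Hf. rewrite <- E. now apply H. Qed.

Lemma op_repr_hyp_factor m a c j :
  m <> 0%Z ->
  permissible (c + IZR (j - 1) * ((a - c) / IZR m)) ->
  op_repr (hyp_factor m a c j)
    (fun f => tpow (a - c - 1) * fhyp_wrt (IZR m) (c + IZR j * ((a - c) / IZR m))
        (c + IZR (j - 1) * ((a - c) / IZR m)) f)%fps.
Proof.
  intros Hm Hp. unfold hyp_factor.
  pose proof (op_repr_comp _ _ _ _ (op_repr_one_sub_Fm m ((a - c - 1) / IZR m))
    (op_repr_hyp_wrt m (c + IZR j * ((a - c) / IZR m)) _ Hm Hp)) as H.
  replace (IZR m * ((a - c - 1) / IZR m)) with (a - c - 1) in H
    by (field; now apply IZR_neq0).
  exact H.
Qed.

Lemma op_repr_hyp_factor_inv m a c j :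
  m <> 0%Z ->
  permissible (c + IZR j * ((a - c) / IZR m)) ->
  permissible (c + IZR (j - 1) * ((a - c) / IZR m)) ->
  op_repr (op_inv (hyp_factor m a c j))
    (fun f => fhyp_wrt (IZR m) (c + IZR (j - 1) * ((a - c) / IZR m))
        (c + IZR j * ((a - c) / IZR m)) (tpow (1 - (a - c)) * f))%fps.
Proof.
  intros Hm Hp Hp'.
  assert (HT : forall f, (tpow (a - c - 1) * (tpow (1 - (a - c)) * f) = f)%fps).
  { intros f. transitivity ((tpow (a - c - 1) * tpow (1 - (a - c))) * f)%fps; [ring|].
    rewrite tpow_add. replace (a - c - 1 + (1 - (a - c))) with (RtoC 0) by ring.
    rewrite tpow_zero. ring. }
  assert (HT' : forall f, (tpow (1 - (a - c)) * (tpow (a - c - 1) * f) = f)%fps).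
  { intros f. rewrite <- (HT f) at 2. ring. }
  eapply op_repr_inv.
  - now apply op_repr_hyp_factor.
  - apply (op_repr_comp _ (op_mul (fun x => Cpower (1 - x) (1 - (a - c)))) _
      (fun f => tpow (1 - (a - c)) * f)%fps
      (op_repr_hyp_wrt m (c + IZR (j - 1) * ((a - c) / IZR m)) _ Hm Hp)).
    intros f b Hf. apply repr_mul; [apply repr_Cpower_1_sub | exact Hf].
  - intros f. cbv beta. rewrite fhyp_wrt_inverse by assumption. apply HT.
  - intros f. cbv beta. rewrite HT'. now apply fhyp_wrt_inverse.
Qed.

Theorem theorem1 (m : Z) (a c : C)
    (m_neq0 : m <> 0%Z)
    (m_or_ac : (m = -2 \/ m = -1 \/ m = 1 \/ m = 2)%Z \/
               (exists k : Z, a - c = RtoC (IZR k)))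
    (perm : forall j : nat, (j < Z.abs_nat m)%nat ->
      permissible (c + RtoC (INR j) * ((a - c) / RtoC (IZR (Z.abs m)))))
    (perm_neg : (m < 0)%Z ->
      permissible
        (c + RtoC (IZR (Z.abs m)) * ((a - c) / RtoC (IZR (Z.abs m))))) :
  op_eq (hyp a c)
    (op_pow (mx_over_y m) (1 - c) **
     op_pow (fun x => 1 - Fm m x) (1 + (c - a) / RtoC (IZR m)) **
     op_prod (hyp_factor m a c) m **
     op_pow (mx_over_y m) (a - 1))%op.
Proof.
  clear m_or_ac.
  set (M := Z.abs_nat m) in *.
  set (d := (a - c) / RtoC (IZR (Z.abs m))) in *.
  assert (HM : (0 < M)%nat) by lia.
  assert (EM : IZR (Z.abs m) = INR M) by (rewrite INR_IZR_INZ; f_equal; lia).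
  assert (HM0 : RtoC (INR M) <> 0) by now apply INR_pos_neq0.
  assert (Ed : c + INR M * d = a).
  { unfold d. rewrite EM. field. exact HM0. }
  assert (Hc : permissible c).
  { replace c with (c + INR 0 * d) by (simpl; ring). now apply perm. }
  assert (Hprod : exists be1 be2,
    op_repr (op_prod (hyp_factor m a c) m) (fprod (fhyp_step (IZR m) be1 be2 c d) M) /\
    forall f, frhs (IZR m) be1 be2 M c d f = fhyp (c + INR M * d) c f).
  { destruct (Z.lt_total m 0) as [Hneg|[Hz|Hpos]]; [|contradiction|].
    - assert (Em : RtoC (IZR m) = - INR M).
      { rewrite <- EM, <- RtoC_opp. f_equal. rewrite <- opp_IZR. f_equal. lia. }
      exists 0, (1 - INR M * d). split.
      + destruct m as [|p|p]; try lia. cbn [op_prod].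
        change (Pos.to_nat p) with M.
        apply op_repr_prod. intros j Hj.
        assert (E1 : c + IZR (1 - Z.of_nat j) * ((a - c) / IZR (Z.neg p))
          = c + (INR j - 1) * d).
        { rewrite minus_IZR, <- INR_IZR_INZ, RtoC_minus, Em. unfold d. rewrite EM.
          field; exact HM0. }
        assert (E2 : c + IZR (1 - Z.of_nat j - 1) * ((a - c) / IZR (Z.neg p))
          = c + INR j * d).
        { replace (1 - Z.of_nat j - 1)%Z with (- Z.of_nat j)%Z by lia.
          rewrite opp_IZR, <- INR_IZR_INZ, RtoC_opp, Em. unfold d. rewrite EM.
          field; exact HM0. }
        pose proof (op_repr_hyp_factor_inv (Z.neg p) a c (1 - Z.of_nat j) m_neq0) as H.
        rewrite E1, E2 in H.
        refine (op_repr_iff _ _ _ _ (H _ _)).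
        * intros f. unfold fhyp_step. rewrite tpow_zero.
          replace (1 - (a - c)) with (1 - INR M * d) by (rewrite <- Ed; ring). ring.
        * destruct j as [|j]; [lia|]. rewrite RtoC_INR_S.
          replace (INR j + 1 - 1) with (RtoC (INR j)) by ring. apply perm. lia.
        * destruct (Nat.eq_dec j M) as [->|Hne].
          -- rewrite <- EM. now apply perm_neg.
          -- apply perm. lia.
      + intros f. rewrite Em. apply frhs_neg; [exact HM | | exact perm].
        intros g. rewrite <- Em. now apply comp_fPhi_fY.
    - assert (Em : RtoC (IZR m) = INR M) by (rewrite <- EM; f_equal; f_equal; lia).
      exists (INR M * d - 1), 0. split.
      + destruct m as [|p|p]; try lia. cbn [op_prod].
        change (Pos.to_nat p) with M.
        apply op_repr_prod. intros j Hj.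
        assert (E1 : c + IZR (Z.of_nat j) * ((a - c) / IZR (Z.pos p)) = c + INR j * d).
        { rewrite <- INR_IZR_INZ. reflexivity. }
        assert (E2 : c + IZR (Z.of_nat j - 1) * ((a - c) / IZR (Z.pos p))
          = c + (INR j - 1) * d).
        { rewrite minus_IZR, <- INR_IZR_INZ, RtoC_minus. reflexivity. }
        pose proof (op_repr_hyp_factor (Z.pos p) a c (Z.of_nat j) m_neq0) as H.
        rewrite E1, E2 in H.
        refine (op_repr_iff _ _ _ _ (H _)).
        * intros f. unfold fhyp_step. rewrite tpow_zero.
          replace (a - c - 1) with (INR M * d - 1) by (rewrite <- Ed; ring).
          do 2 f_equal. ring.
        * destruct j as [|j]; [lia|]. rewrite RtoC_INR_S.
          replace (INR j + 1 - 1) with (RtoC (INR j)) by ring. apply perm. lia.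
      + intros f. rewrite Em. apply frhs_pos; [exact HM | | exact perm].
        intros g. rewrite <- Em. now apply comp_fPhi_fY. }
  destruct Hprod as (be1 & be2 & Hprod & Hid).
  intros f Hf. apply analytic0_repr in Hf. destruct Hf as (b & Hb).
  apply locally_near0, (repr_germ _ _ (fhyp a c b)); [now apply op_repr_hyp|].
  rewrite <- Ed at 4. rewrite <- Hid. unfold frhs.
  unfold op_comp.
  apply op_repr_mx_over_y; [exact m_neq0|].
  replace (IZR m - INR M * d) with (IZR m * (1 + (c - a) / IZR m))
    by (replace (INR M * d) with (a - c) by (rewrite <- Ed; ring);
        field; now apply IZR_neq0).
  apply op_repr_one_sub_Fm, Hprod. rewrite Ed.
  now apply op_repr_mx_over_y.
Qed.
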